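(* For every extensional ESO sentence $\Psi$ there exists a first-order sentence $\phi$ (over some finite relational signature) such that the problem described by $\neg\Psi$ is log-space equivalent to $\mathrm{Her}(\phi)$.
   Context: All signatures are finite and relational, and all structures have non-empty domains. An ESO (existential second-order) $\tau$-sentence has the form $\exists R_1,\dots,R_k.\,\phi$, where $R_1,\dots,R_k$ are relation symbols not in $\tau$ and $\phi$ is a first-order $(\tau\cup\{R_1,\dots,R_k\})$-sentence. The problem described by a (second-order) $\tau$-sentence is the class of finite $\tau$-structures satisfying it, viewed as a decision problem on (encodings of) finite $\tau$-structures. An ESO $\tau$-sentence $\Psi$ is extensional if for every existentially quantified predicate $R$ there is a distinct symbol $R'\in\tau$ of the same arity such that $\Psi$ contains a conjunct $\forall\bar x\,(R'(\bar x)\Rightarrow R(\bar x))$, and $R'$ does not appear anywhere else in $\Psi$. For a first-order $\sigma$-sentence $\phi$, $\mathrm{Her}(\phi)$ is the class of finite $\sigma$-structures $\mathbb A$ such that all non-empty (induced) substructures of $\mathbb A$ satisfy $\phi$. Two problems are log-space equivalent if each has a log-space computable many-one reduction to the other. *)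

(* Defs.v *)
From HB Require Import structures.
From mathcomp Require Import all_boot.
Set Implicit Arguments.
Unset Strict Implicit.
Unset Printing Implicit Defensive.

Record signature := Signature { sym : finType; arity : sym -> nat }.

Definition sig_union (tau rho : signature) : signature :=
  @Signature (sym tau + sym rho)%type
    (fun R => match R with inl Q => arity Q | inr Q => arity Q end).

Record structure (sigma : signature) := Structure {
  dom : finType;
  dom_gt0 : 0 < #|dom|;
  interp : forall R : sym sigma, {set (arity R).-tuple dom} }.

Section Induced.
Variables (sigma : signature) (A : structure sigma) (S : {set dom A}).

Lemma card_induced : S != set0 -> 0 < #|{: {x : dom A | x \in S}}|.
Proof. by rewrite card_sig card_gt0. Qed.

Definition induced (hS : S != set0) : structure sigma :=
  @Structure sigma {x : dom A | x \in S} (card_induced hS)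
    (fun R => [set t | map_tuple val t \in interp A R]).

End Induced.

(* First-order formulas with equality; variables are named by nat. *)
Inductive formula (sigma : signature) : Type :=
  | FFalse
  | FEq of nat & nat
  | FRel (R : sym sigma) of (arity R).-tuple nat
  | FNot of formula sigma
  | FAnd of formula sigma & formula sigma
  | FOr of formula sigma & formula sigma
  | FImp of formula sigma & formula sigma
  | FAll of nat & formula sigma
  | FEx of nat & formula sigma.

Arguments FFalse {sigma}.
Arguments FEq {sigma} _ _.
Arguments FRel {sigma} R _.

Fixpoint free_vars (sigma : signature) (phi : formula sigma) : seq nat :=
  match phi with
  | FFalse => [::]
  | FEq x y => [:: x; y]
  | FRel _ xs => xs
  | FNot p => free_vars p
  | FAnd p q | FOr p q | FImp p q => free_vars p ++ free_vars q
  | FAll x p | FEx x p => [seq y <- free_vars p | y != x]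
  end.

Definition sentence (sigma : signature) (phi : formula sigma) : bool :=
  nilp (free_vars phi).

Fixpoint sat (sigma : signature) (A : structure sigma) (v : nat -> dom A)
    (phi : formula sigma) : bool :=
  match phi with
  | FFalse => false
  | FEq x y => v x == v y
  | FRel R xs => map_tuple v xs \in interp A R
  | FNot p => ~~ sat v p
  | FAnd p q => sat v p && sat v q
  | FOr p q => sat v p || sat v q
  | FImp p q => sat v p ==> sat v q
  | FAll x p => [forall a : dom A, sat [eta v with x |-> a] p]
  | FEx x p => [exists a : dom A, sat [eta v with x |-> a] p]
  end.

(* Only meant for sentences, whose truth value does not depend on v. *)
Definition models (sigma : signature) (A : structure sigma)
    (phi : formula sigma) : Prop :=
  forall v : nat -> dom A, sat v phi.

Definition Her (sigma : signature) (phi : formula sigma)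
    (A : structure sigma) : Prop :=
  forall (S : {set dom A}) (hS : S != set0), models (induced hS) phi.

(* The sentence "exists R_1 ... R_k, eso_body", where R_1, ..., R_k are the
   symbols of eso_sig. *)
Record eso (tau : signature) := Eso {
  eso_sig : signature;
  eso_body : formula (sig_union tau eso_sig);
  eso_closed : sentence eso_body }.

Definition expansion (tau rho : signature) (A : structure tau)
    (I : forall R : sym rho, {set (arity R).-tuple (dom A)}) :
    structure (sig_union tau rho) :=
  @Structure (sig_union tau rho) (dom A) (dom_gt0 A)
    (fun R => match R with inl Q => interp A Q | inr Q => I Q end).

Definition eso_models (tau : signature) (A : structure tau)
    (Psi : eso tau) : Prop :=
  exists I : forall R : sym (eso_sig Psi), {set (arity R).-tuple (dom A)},
    models (expansion I) (eso_body Psi).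

Fixpoint conjunct (sigma : signature) (chi phi : formula sigma) : Prop :=
  phi = chi \/
  match phi with
  | FAnd p q => conjunct chi p \/ conjunct chi q
  | _ => False
  end.

Fixpoint occurrences (sigma : signature) (R : sym sigma)
    (phi : formula sigma) : nat :=
  match phi with
  | FFalse | FEq _ _ => 0
  | FRel Q _ => Q == R
  | FNot p | FAll _ p | FEx _ p => occurrences R p
  | FAnd p q | FOr p q | FImp p q => occurrences R p + occurrences R q
  end.

Definition foralls (sigma : signature) (xs : seq nat) (phi : formula sigma) :
    formula sigma :=
  foldr (@FAll sigma) phi xs.

(* As the displayed conjunct contains R' once, "R' does not appear anywhere
   else" says that R' has exactly one occurrence. *)
Definition extensional (tau : signature) (Psi : eso tau) : Prop :=
  exists2 prime : sym (eso_sig Psi) -> sym tau, injective prime &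
  forall R : sym (eso_sig Psi),
    let R1 : sym (sig_union tau (eso_sig Psi)) := inl (prime R) in
    let R2 : sym (sig_union tau (eso_sig Psi)) := inr R in
    occurrences R1 (eso_body Psi) = 1 /\
    exists (e : arity R1 = arity R2) (xs : (arity R1).-tuple nat),
      uniq xs /\
      conjunct (foralls xs (FImp (FRel R1 xs) (FRel R2 (tcast e xs))))
        (eso_body Psi).

(* All r-tuples in lexicographic order (the order of enum on tuple types is
   left unspecified by the library). *)
Fixpoint lex_tuples (T : finType) (r : nat) : seq (r.-tuple T) :=
  match r with
  | 0 => [:: [tuple]]
  | r'.+1 =>
    [seq cons_tuple x t | x <- enum T, t <- lex_tuples T r']
  end.

(* The domain size in unary, then the characteristic bit table of each
   relation; the domain is ordered by enum. *)
Definition encode (sigma : signature) (A : structure sigma) : seq bool :=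
  nseq #|dom A| true ++ false ::
  flatten [seq [seq t \in interp A R | t <- lex_tuples (dom A) (arity R)]
          | R <- enum (sym sigma)].

(* Deterministic Turing transducers: a two-way read-only input tape with end
   markers, work tapes, and a one-way write-only output tape. *)
Inductive move := MoveLeft | Stay | MoveRight.

Inductive input_symbol := LeftEnd | InputBit of bool | RightEnd.

Record transducer := Transducer {
  state : finType;
  start : state;
  work_alphabet : finType;
  blank : work_alphabet;
  num_tapes : nat;
  (* None means halting; an action consists of the next state, the move of the
     input head, the symbol written and the move on each work tape, and the
     optional output bit. *)
  delta : state -> input_symbol -> {ffun 'I_num_tapes -> work_alphabet} ->
    option (state * move * ('I_num_tapes -> work_alphabet * move)
            * option bool) }.

Section Runs.
Variables (M : transducer) (w : seq bool).

(* Work tapes are infinite to the right, with cells numbered from 0. *)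
Record config := Config {
  cstate : state M;
  cinput : nat;
  chead : 'I_(num_tapes M) -> nat;
  ctape : 'I_(num_tapes M) -> nat -> work_alphabet M;
  coutput : seq bool }.

Definition init_config : config :=
  Config (start M) 0 (fun=> 0) (fun _ _ => blank M) [::].

(* Positions 0 and (size w).+1 carry the end markers. *)
Definition input_at (p : nat) : input_symbol :=
  if p is p'.+1 then
    if p' < size w then InputBit (nth false w p') else RightEnd
  else LeftEnd.

Definition move_head (m : move) (p : nat) : nat :=
  match m with MoveLeft => p.-1 | Stay => p | MoveRight => p.+1 end.

Definition step (c : config) : option config :=
  omap
    (fun act =>
      let: (q, m, work, o) := act in
      Config q
        (minn (move_head m (cinput c)) (size w).+1)
        (fun i => move_head (work i).2 (chead c i))
        (fun i => [eta ctape c i with chead c i |-> (work i).1])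
        (if o is Some b then rcons (coutput c) b else coutput c))
    (delta (cstate c) (input_at (cinput c)) [ffun i => ctape c i (chead c i)]).

Definition run (t : nat) : option config := iter t (obind step) (Some init_config).

Definition outputs (u : seq bool) : Prop :=
  exists t c, [/\ run t = Some c, step c = None & coutput c = u].

Definition runs_in_space (s : nat) : Prop :=
  forall t c, run t = Some c -> forall i, chead c i < s.

End Runs.

Definition logspace_computable (tau sigma : signature)
    (f : structure tau -> structure sigma) : Prop :=
  exists (M : transducer) (c : nat), forall A : structure tau,
    outputs M (encode A) (encode (f A)) /\
    runs_in_space M (encode A) (c * (trunc_log 2 (size (encode A))).+1).

Definition logspace_reducible (tau sigma : signature)
    (P : structure tau -> Prop) (Q : structure sigma -> Prop) : Prop :=
  exists2 f : structure tau -> structure sigma,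
    logspace_computable f & forall A, P A <-> Q (f A).

Definition logspace_equivalent (tau sigma : signature)
    (P : structure tau -> Prop) (Q : structure sigma -> Prop) : Prop :=
  logspace_reducible P Q /\ logspace_reducible Q P.

(* Main.v *)
Require Import Defs.
From mathcomp Require Import all_boot.
From Stdlib Require Import FunctionalExtensionality Setoid Classical_Prop.

Set Implicit Arguments.
Unset Strict Implicit.
Unset Printing Implicit Defensive.

(** Let Psi quantify relations R, each extended from an input relation R'. As
    R' occurs only in the inclusion of R' in R, a structure A satisfies Psi iff
    there are relations I, containing the relations R', that satisfy the rest of
    the sentence, which does not mention R' ([sat_split_extension]).

    A choice of I is a choice of a substructure. Add to A, for each tuple outside
    of R', an element tied to it by a new relation symbol. In a substructure that
    contains all of A, the elements that are left describe I: a tuple belongs to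
    I iff no element left is tied to it. All relations I containing R' arise in
    this way, and the rest of Psi, relativised to A and with the atoms of R
    replaced by the absence of a tied element, becomes a first-order condition
    on the substructure. So A satisfies Psi iff some substructure satisfies that
    condition, and the hereditary sentence is its negation ([her_link]).

    Two points need care. First, a substructure must not lose elements of A, and
    it cannot see what was lost. Therefore A carries a linear order and its
    cyclic successor relation. The condition asks every element to have a
    successor; if an element is missing, the last element before it has none
    ([linked_full]). Second, the hereditary class contains structures that do
    not come from any A. Being a linear order with a correct successor relation,
    and being tied to at most one tuple, are universal conditions; they are
    inherited by substructures and are added to the hereditary sentence, so that
    a structure violating them is not hereditary. If they hold but a successor
    is missing, no substructure can satisfy the condition and the structure is
    hereditary. In the remaining case A can be read off. So the two exceptional
    kinds of structures can be sent to a fixed model and a fixed non-model of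
    Psi; if one of these does not exist, both problems are trivial.

    To see that the reductions take logarithmic space, programs over registers
    bounded by the length of the input are compiled to transducers with one
    binary counter for each register ([logspace_computable_rprog]). Such programs
    look up a bit of the encoding by computing its position, evaluate first-order
    formulas by nested loops ([run_eval]), and print the tables of a structure
    in the order of the encoding ([emits_structure]). For the map from A, the
    elements tied to tuples are taken to be the positions in the encoding of A,
    which makes the tie between an element and a tuple an arithmetical relation
    ([positions_correct]). The map back is a first-order interpretation
    ([recovery_correct]). *)


(** * Structured programs for transducers *)

Definition cell : finType := option (option bool).

(** A tape: the cells to the left of the head in reverse order, and the cells
    from the head on. Cells that are not listed are blank. *)
Definition zipper : Type := seq cell * seq cell.

Definition read_cell (z : zipper) : cell := head None z.2.

(** Drops a final blank, so that a head that walks over a stretch of tape and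
    back restores the zipper itself and not just the tape it stands for. *)
Definition push (y : cell) (r : seq cell) : seq cell :=
  if (y == None) && nilp r then [::] else y :: r.

(** A head that stays and rewrites what it reads leaves the zipper as it is,
    even beyond the last listed cell: this is how an instruction for one tape
    treats the other tapes. *)
Definition act_cell (z : zipper) (a : cell * move) : zipper :=
  match a.2, z.1 with
  | MoveRight, _ => (a.1 :: z.1, behead z.2)
  | MoveLeft, x :: l => (l, x :: push a.1 (behead z.2))
  | _, _ => (z.1, if a.1 == read_cell z then z.2 else a.1 :: behead z.2)
  end.

Definition tape_of (z : zipper) : nat -> cell := nth None (rev z.1 ++ z.2).

Lemma tape_of_read z : tape_of z (size z.1) = read_cell z.
Proof.
case: z => l r; rewrite /tape_of /read_cell /= nth_cat size_rev ltnn subnn.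
by case: r.
Qed.

Lemma act_cell_id z : act_cell z (read_cell z, Stay) = z.
Proof. by case: z => l r; rewrite /act_cell /= eqxx. Qed.

Lemma tape_of_act z a :
  tape_of (act_cell z a) = [eta tape_of z with size z.1 |-> a.1].
Proof.
apply: functional_extensionality => j; case: z a => l r [y mv].
have E : nth None (rev l ++ y :: behead r) j
       = [eta tape_of (l, r) with size l |-> y] j.
  rewrite /= /tape_of /= !nth_cat size_rev.
  case: ltngtP => [jl|lj|->] //=; last by rewrite subnn.
  rewrite -(subnSK lj) /=; case: (r) => [|x r'] //=.
  by rewrite nth_nil.
have stay : tape_of (l, if y == read_cell (l, r) then r else y :: behead r) j
          = [eta tape_of (l, r) with size l |-> y] j.
  case: eqP => [->|_]; last exact: E.
  by rewrite /=; case: eqP => [->|//]; rewrite -(tape_of_read (l, r)).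
case: mv; rewrite /act_cell /=.
- case: l E stay => [|x l] //= <- _; rewrite /tape_of /= rev_cons cat_rcons.
  rewrite /push; case: andP => [[/eqP-> /nilP->]|//].
  rewrite !nth_cat /=; case: ifP => // _.
  by case: (_ - _) => [|[|n]] //=; rewrite !nth_nil.
- exact: stay.
- by move: E => /= <-; rewrite /tape_of /= rev_cons cat_rcons.
Qed.

Lemma size_act z a : size (act_cell z a).1 = move_head a.2 (size z.1).
Proof. by case: z a => [[|x l] r] [y []]. Qed.

Definition action (k : nat) : Type :=
  move * ('I_k -> cell * move) * option bool.

(** A program ends with a boolean, so that any program can be the condition of
    [If] and [While]; the only way to act is [Prim], one step of a transducer. *)
Inductive prog (k : nat) : Type :=
  | Prim of (input_symbol -> {ffun 'I_k -> cell} -> bool * action k)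
  | If of prog k & prog k & prog k
  | While of prog k & prog k.

Record memory (k : nat) := Memory {
  mpos : nat; mtapes : 'I_k -> zipper; mout : seq bool }.

Section Programs.
Variable k : nat.
Implicit Types (p q r : prog k) (m : memory k).

Definition symbols m : {ffun 'I_k -> cell} := [ffun i => read_cell (mtapes m i)].

(** The control states of a program are the occurrences of [Prim] in it. *)
Fixpoint point p : finType :=
  match p with
  | Prim _ => unit
  | If p q r => (point p + (point q + point r))%type
  | While p q => (point p + point q)%type
  end.

Fixpoint entry p : point p :=
  match p with
  | Prim _ => tt
  | If p q r => inl (entry p)
  | While p q => inl (entry p)
  end.

Fixpoint next p {struct p} : point p -> input_symbol -> {ffun 'I_k -> cell} ->
    (point p + bool) * action k :=
  match p with
  | Prim f => fun _ x y => (inr (f x y).1, (f x y).2)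
  | If p q r => fun pt x y =>
      match pt with
      | inl pt =>
        let: (nx, a) := next pt x y in
        (match nx with
         | inl pt' => inl (inl pt')
         | inr true => inl (inr (inl (entry q)))
         | inr false => inl (inr (inr (entry r)))
         end, a)
      | inr (inl pt) =>
        let: (nx, a) := next pt x y in
        (match nx with inl pt' => inl (inr (inl pt')) | inr b => inr b end, a)
      | inr (inr pt) =>
        let: (nx, a) := next pt x y in
        (match nx with inl pt' => inl (inr (inr pt')) | inr b => inr b end, a)
      end
  | While p q => fun pt x y =>
      match pt with
      | inl pt =>
        let: (nx, a) := next pt x y in
        (match nx with
         | inl pt' => inl (inl pt')
         | inr true => inl (inr (entry q))
         | inr false => inr false
         end, a)
      | inr pt =>
        let: (nx, a) := next pt x y in
        (match nx with
         | inl pt' => inl (inr pt')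
         | inr _ => inl (inl (entry p))
         end, a)
      end
  end.

Definition machine p : transducer :=
  @Transducer (option (point p)) (Some (entry p)) cell None k
    (fun st x y =>
       if st is Some pt then
         let: (nx, a) := next pt x y in
         Some (if nx is inl pt' then Some pt' else None, a.1.1, a.1.2, a.2)
       else None).

Section Execution.
Variables (w : seq bool) (s : nat).

Definition do_action m (a : action k) : memory k :=
  Memory (minn (move_head a.1.1 (mpos m)) (size w).+1)
      (fun i => act_cell (mtapes m i) (a.1.2 i))
      (if a.2 is Some b then rcons (mout m) b else mout m).

Definition in_space m : Prop := forall i, size (mtapes m i).1 < s.

(** Executions in which no head reaches cell [s]. A derivation is a terminating
    execution, whatever its length: only space has to be controlled. *)
Inductive exec : prog k -> memory k -> bool -> memory k -> Prop :=
  | ExecPrim f m (a := f (input_at w (mpos m)) (symbols m)) :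
      in_space (do_action m a.2) -> exec (Prim f) m a.1 (do_action m a.2)
  | ExecIf p q r m b m' b' m'' :
      exec p m b m' -> exec (if b then q else r) m' b' m'' ->
      exec (If p q r) m b' m''
  | ExecStop p q m m' : exec p m false m' -> exec (While p q) m false m'
  | ExecLoop p q m m1 b m2 b' m3 :
      exec p m true m1 -> exec q m1 b m2 -> exec (While p q) m2 b' m3 ->
      exec (While p q) m b' m3.

Section Simulation.
Variable P : prog k.
Let M := machine P.

Definition cfg (q : state M) m : config M :=
  @Config M q (mpos m) (fun i => size (mtapes m i).1)
    (fun i => tape_of (mtapes m i)) (mout m).

Inductive reach : config M -> config M -> Prop :=
  | ReachRefl c : reach c c
  | ReachStep c c' c'' :
      step w c = Some c' -> (forall i, chead c' i < s) -> reach c' c'' ->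
      reach c c''.

Lemma reach_trans c c' c'' : reach c c' -> reach c' c'' -> reach c c''.
Proof.
by move=> r; elim: r c'' => // {}c c1 c2 st sp _ IH c3 /IH; apply: ReachStep.
Qed.

Lemma step_cfg (pt : point P) m :
  let na := next pt (input_at w (mpos m)) (symbols m) in
  step w (cfg (Some pt) m) =
    Some (cfg (if na.1 is inl pt' then Some pt' else None) (do_action m na.2)).
Proof.
rewrite /step /cfg /=.
have -> : [ffun i => tape_of (mtapes m i) (size (mtapes m i).1)] = symbols m.
  by apply/ffunP=> i; rewrite !ffunE tape_of_read.
case: next => nx [[mv a] o] /=; congr Some.
congr (@Config M); apply: functional_extensionality => i /=.
  by rewrite size_act.
by rewrite tape_of_act.
Qed.

(** The program [p] sits in [P] through [g] and passes control to [ex b] when it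
    ends with [b]. Simulation is stated for parts of a fixed machine, so that
    the induction on executions never has to compare two machines. *)
Definition embeds p (g : point p -> point P) (ex : bool -> option (point P)) :=
  forall pt x y,
    ((if (next (g pt) x y).1 is inl pt' then Some pt' else None) =
     match (next pt x y).1 with inl pt' => Some (g pt') | inr b => ex b end) /\
    (next (g pt) x y).2 = (next pt x y).2.

Lemma exec_reach p m b m' : exec p m b m' ->
  forall (g : point p -> point P) ex, embeds g ex ->
  reach (cfg (Some (g (entry p))) m) (cfg (ex b) m').
Proof.
elim=> {p m b m'} [f m a sp|p q r m b m' b' m'' _ IHp _ IHq|p q m m' _ IHp|
    p q m m1 b m2 b' m3 _ IHp _ IHq _ IHw] g ex emb.
- have st : step w (cfg (Some (g (entry (Prim f)))) m)
      = Some (cfg (ex a.1) (do_action m a.2)).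
    by rewrite step_cfg; case: (emb tt (input_at w (mpos m)) (symbols m)) => -> ->.
  exact: ReachStep st sp (ReachRefl _).
- have e1 : embeds (fun pt => g (inl pt))
      (fun c => Some (g (inr (if c then inl (entry q) else inr (entry r))))).
    move=> pt x y; case: (emb (inl pt) x y) => -> -> /=.
    by case: next => [[pt'|[]] a'].
  apply: reach_trans (IHp _ _ e1) _.
  case: b IHq {IHp} => IH.
    apply: (IH (fun pt => g (inr (inl pt)))) => pt x y.
    by case: (emb (inr (inl pt)) x y) => -> -> /=; case: next => [[pt'|c] a'].
  apply: (IH (fun pt => g (inr (inr pt)))) => pt x y.
  by case: (emb (inr (inr pt)) x y) => -> -> /=; case: next => [[pt'|c] a'].
- apply: (IHp (fun pt => g (inl pt))
            (fun c => if c then Some (g (inr (entry q))) else ex false)).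
  move=> pt x y; case: (emb (inl pt) x y) => -> -> /=.
  by case: next => [[pt'|[]] a'].
- have e1 : embeds (fun pt => g (inl pt))
     (fun c => if c then Some (g (inr (entry q))) else ex false).
    move=> pt x y; case: (emb (inl pt) x y) => -> -> /=.
    by case: next => [[pt'|[]] a'].
  have e2 : embeds (fun pt => g (inr pt)) (fun=> Some (g (inl (entry p)))).
    move=> pt x y; case: (emb (inr pt) x y) => -> -> /=.
    by case: next => [[pt'|c] a'].
  apply: reach_trans (IHp _ _ e1) _; apply: reach_trans (IHq _ _ e2) _.
  exact: IHw.
Qed.

End Simulation.

(** A transducer is deterministic, so its run consists of the configurations on
    the path that leads to the halting one. *)
Lemma reach_run P (c c' : config (machine P)) : reach c c' -> step w c' = None ->
  (forall i, chead c i < s) ->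
  (exists t, iter t (obind (@step (machine P) w)) (Some c) = Some c') /\
  forall t c1, iter t (obind (@step (machine P) w)) (Some c) = Some c1 ->
    forall i, chead c1 i < s.
Proof.
elim=> {c c'} [c|c c' c'' st sp _ IH] halt sp0.
  split; first by exists 0.
  case=> [|t] c1; first by case=> <-.
  have -> : iter t.+1 (obind (@step (machine P) w)) (Some c) = None.
    by rewrite iterSr /= halt; elim: t => //= t ->.
  by [].
case: (IH halt sp) => -[t run] sp'; split.
  by exists t.+1; rewrite iterSr /= st.
case=> [|t'] c1; first by case=> <-.
by rewrite iterSr /= st; apply: sp'.
Qed.

Theorem exec_machine p b m : 0 < s ->
  exec p (Memory 0 (fun=> ([::], [::])) [::]) b m ->
  outputs (machine p) w (mout m) /\ runs_in_space (machine p) w s.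
Proof.
move=> s0 ex; set m0 := Memory _ _ _ in ex.
have emb : @embeds p p id (fun=> None) by move=> pt x y; case: next => [[]].
have init : init_config (machine p) = cfg (Some (entry p)) m0.
  rewrite /init_config /cfg /=; congr (@Config (machine p)).
  by do 2![apply: functional_extensionality => ?]; rewrite /tape_of nth_nil.
have r := exec_reach ex emb; rewrite -init in r.
have [| [t run] sp] := reach_run r (erefl _) _; first by [].
by split=> //; exists t, (cfg None m).
Qed.

End Execution.
End Programs.


(** * Binary counters and register programs *)

Fixpoint bin_succ (s : seq bool) : seq bool :=
  match s with
  | [::] => [:: true]
  | true :: s => false :: bin_succ s
  | false :: s => true :: s
  end.

(** Least significant bit first and without superfluous zeros, because it grows
    only by [bin_succ]; hence a number has one representation, and two counters
    are compared digit by digit. *)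
Definition bin (n : nat) : seq bool := iter n bin_succ [::].

Fixpoint bin_value (s : seq bool) : nat :=
  if s is b :: s then b + (bin_value s).*2 else 0.

Lemma bin_succ_value s : bin_value (bin_succ s) = (bin_value s).+1.
Proof. by elim: s => [|[] s IH] //=; rewrite IH doubleS. Qed.

Lemma binK : cancel bin bin_value.
Proof. by elim=> //= n IH; rewrite bin_succ_value IH. Qed.

(** The default [true] makes the empty list count as a list without
    superfluous zeros. *)
Lemma last_bin_succ s b : last true s -> last b (bin_succ s).
Proof. by elim: s b => [|[] s IH] b //=; [apply: IH | case: s {IH}]. Qed.

Lemma size_bin_value s : last true s -> 0 < size s ->
  2 ^ (size s).-1 <= bin_value s.
Proof.
elim: s => [|b [|c s] IH] //=; first by case: b.
move=> ls _; apply: leq_trans (leq_addl _ _).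
by rewrite expnS mul2n leq_double; apply: IH.
Qed.

Lemma size_bin n : size (bin n) <= (trunc_log 2 n).+1.
Proof.
have lb : last true (bin n) by elim: n => //= n /last_bin_succ.
case: (posnP (size (bin n))) => [->//|sz].
have := size_bin_value lb sz; rewrite binK => le.
by rewrite -(prednK sz) ltnS; apply: trunc_log_max.
Qed.

(** Programs over registers that hold natural numbers. Together with the guard
    of [RxInc], which keeps registers below the length of the input plus two,
    they describe logarithmic space. *)
Inductive rprog : Type :=
  | Inc of nat
  | Reset of nat
  | EqR of nat & nat
  | InL
  | InR
  | Read of (input_symbol -> bool)
  | Out of bool
  | RIf of rprog & rprog & rprog
  | RWhile of rprog & rprog.

Record rstate := RState { reg : nat -> nat; ipos : nat; out : seq bool }.

Section RegisterSemantics.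
Variable w : seq bool.

Inductive rexec : rprog -> rstate -> bool -> rstate -> Prop :=
  | RxInc i v p o : v i <= size w ->
      rexec (Inc i) (RState v p o) true
        (RState [eta v with i |-> (v i).+1] p o)
  | RxReset i v p o :
      rexec (Reset i) (RState v p o) true (RState [eta v with i |-> 0] p o)
  | RxEq i j s : rexec (EqR i j) s (reg s i == reg s j) s
  | RxL v p o : rexec InL (RState v p o) true (RState v p.-1 o)
  | RxR v p o :
      rexec InR (RState v p o) true (RState v (minn p.+1 (size w).+1) o)
  | RxRead f s : rexec (Read f) s (f (input_at w (ipos s))) s
  | RxOut c v p o : rexec (Out c) (RState v p o) true (RState v p (rcons o c))
  | RxIf p q r s b s' b' s'' :
      rexec p s b s' -> rexec (if b then q else r) s' b' s'' ->
      rexec (RIf p q r) s b' s''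
  | RxStop p q s s' : rexec p s false s' -> rexec (RWhile p q) s false s'
  | RxLoop p q s s1 b s2 b' s3 :
      rexec p s true s1 -> rexec q s1 b s2 -> rexec (RWhile p q) s2 b' s3 ->
      rexec (RWhile p q) s b' s3.

End RegisterSemantics.

Fixpoint max_reg (p : rprog) : nat :=
  match p with
  | Inc i | Reset i => i
  | EqR i j => maxn i j
  | InL | InR | Read _ | Out _ => 0
  | RIf p q r => maxn (max_reg p) (maxn (max_reg q) (max_reg r))
  | RWhile p q => maxn (max_reg p) (max_reg q)
  end.

Definition mark : cell := Some None.
Definition bit (b : bool) : cell := Some (Some b).

(** The mark in cell 0 tells a returning head where to stop. *)
Definition counter (n : nat) : zipper := ([::], mark :: map bit (bin n)).

Section Compilation.
Variable k : nat.
Local Notation K := k.+1.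
Implicit Types (i j : 'I_K) (Z : 'I_K -> zipper) (z : zipper).

Definition idle (y : {ffun 'I_K -> cell}) : 'I_K -> cell * move :=
  fun j => (y j, Stay).

Definition tape_prim i (g : cell -> bool * (cell * move)) : prog K :=
  Prim (fun _ y => ((g (y i)).1, (Stay,
    (fun j => if j == i then (g (y j)).2 else (y j, Stay)), None))).

Definition pure_test (t : input_symbol -> {ffun 'I_K -> cell} -> bool) :
    prog K :=
  Prim (fun x y => (t x y, (Stay, idle y, None))).

Definition halt (b : bool) := pure_test (fun _ _ => b).
Definition seqp (p q : prog K) : prog K := If p q q.

Definition step_right i := tape_prim i (fun c => (true, (c, MoveRight))).

Definition rewind i :=
  While (tape_prim i (fun c =>
    if c == mark then (false, (c, Stay)) else (true, (c, MoveLeft))))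
  (halt true).

(** Starts behind the last digit and writes blanks on its way back. *)
Definition erase i :=
  While (tape_prim i (fun c =>
    if c == mark then (false, (c, Stay)) else (true, (None, MoveLeft))))
  (halt true).

Definition carry i :=
  While (tape_prim i (fun c =>
    if c == bit true then (true, (bit false, MoveRight))
    else (false, (bit true, Stay))))
  (halt true).

Definition to_blank i :=
  While (tape_prim i (fun c =>
    if c == None then (false, (c, Stay)) else (true, (c, MoveRight))))
  (halt true).

Definition inc_prog i :=
  seqp (step_right i) (seqp (carry i) (seqp (rewind i) (halt true))).

Definition reset_prog i :=
  seqp (step_right i) (seqp (to_blank i) (seqp (erase i) (halt true))).

Definition eq_prog i j :=
  if i == j then halt true else
  seqp (seqp (step_right i) (step_right j))
  (seqp (While (pure_test (fun _ y => (y i == y j) && (y i != None)))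
               (seqp (step_right i) (step_right j)))
  (If (pure_test (fun _ y => y i == y j))
     (seqp (rewind i) (seqp (rewind j) (halt true)))
     (seqp (rewind i) (seqp (rewind j) (halt false))))).

Fixpoint compile (p : rprog) : prog K :=
  match p with
  | Inc i => inc_prog (inord i)
  | Reset i => reset_prog (inord i)
  | EqR i j => eq_prog (inord i) (inord j)
  | InL => Prim (fun _ y => (true, (MoveLeft, idle y, None)))
  | InR => Prim (fun _ y => (true, (MoveRight, idle y, None)))
  | Read f => pure_test (fun x _ => f x)
  | Out b => Prim (fun _ y => (true, (Stay, idle y, Some b)))
  | RIf p q r => If (compile p) (compile q) (compile r)
  | RWhile p q => While (compile p) (compile q)
  end.

Definition upd Z i z : 'I_K -> zipper := fun j => if j == i then z else Z j.

Lemma upd_id Z i : upd Z i (Z i) = Z.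
Proof.
by apply: functional_extensionality => j; rewrite /upd; case: eqP => [->|].
Qed.

Lemma updC Z i j z z' : i != j ->
  upd (upd Z i z) j z' = upd (upd Z j z') i z.
Proof.
move=> ij; apply: functional_extensionality => l; rewrite /upd.
by case: eqP => [->|//]; rewrite eq_sym (negPf ij).
Qed.

Section Correct.
Variables (w : seq bool) (s : nat) (pos : nat) (o : seq bool).
Hypothesis pos_le : pos <= (size w).+1.

Local Notation small Z := (forall i, size (Z i).1 < s).
Local Notation ex p Z b Z' := (exec w s p (Memory pos Z o) b (Memory pos Z' o)).

Lemma idle_tapes (Z : 'I_K -> zipper) p' o' :
  (fun i => act_cell (Z i) (idle (symbols (Memory p' Z o')) i)) = Z.
Proof.
by apply: functional_extensionality => i; rewrite /idle /= ffunE act_cell_id.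
Qed.

Lemma ex_test t Z : small Z ->
  ex (pure_test t) Z (t (input_at w pos) (symbols (Memory pos Z o))) Z.
Proof.
move=> sz; set m := Memory pos Z o.
have E : do_action w m (Stay, idle (symbols m), None) = m.
  by rewrite /do_action /= idle_tapes (minn_idPl pos_le).
have := @ExecPrim _ w s (fun x y => (t x y, (Stay, idle y, None))) m.
by rewrite /= E; apply.
Qed.

Lemma ex_halt b Z : small Z -> ex (halt b) Z b Z.
Proof. exact: ex_test. Qed.

Lemma ex_seq p q Z b Z' b' Z'' : ex p Z b Z' -> ex q Z' b' Z'' ->
  ex (seqp p q) Z b' Z''.
Proof. by move=> e1 e2; apply: ExecIf e1 _; case: b. Qed.

Lemma small_upd Z i z : small Z -> size z.1 < s -> small (upd Z i z).
Proof. by move=> sz zs j; rewrite /upd; case: eqP. Qed.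

Lemma ex_tape i g Z z : small Z ->
  let r := g (read_cell z) in
  size (act_cell z r.2).1 < s ->
  ex (tape_prim i g) (upd Z i z) r.1 (upd Z i (act_cell z r.2)).
Proof.
move=> sz r lt; set m := Memory pos (upd Z i z) o.
have ri : symbols m i = read_cell z by rewrite ffunE /= /upd eqxx.
have E : do_action w m (Stay, (fun j => if j == i then (g (symbols m j)).2
           else (symbols m j, Stay)), None) =
         Memory pos (upd Z i (act_cell z r.2)) o.
  rewrite /do_action /= (minn_idPl pos_le); congr Memory.
  apply: functional_extensionality => j; rewrite /upd.
  case: eqP => [->|/eqP ji]; first by rewrite ri.
  by rewrite ffunE /= /upd (negPf ji) act_cell_id.
have := @ExecPrim _ w s (fun _ y => ((g (y i)).1, (Stay,
    (fun j => if j == i then (g (y j)).2 else (y j, Stay)), None))) m.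
rewrite /= E ri; apply; exact: small_upd.
Qed.

(** The loops over one tape do all their work in the test, so that a round is a
    single step of the zipper. *)
Lemma ex_round i (g : cell -> bool * (cell * move)) Z z z' b Z'' : small Z ->
  (g (read_cell z)).1 -> act_cell z (g (read_cell z)).2 = z' ->
  size z'.1 < s ->
  ex (While (tape_prim i g) (halt true)) (upd Z i z') b Z'' ->
  ex (While (tape_prim i g) (halt true)) (upd Z i z) b Z''.
Proof.
move=> sz gt E lt; have := @ex_tape i g Z z sz; rewrite /= E gt => /(_ lt) e1 e2.
by apply: ExecLoop e1 (ex_halt _ _) e2; apply: small_upd.
Qed.

Lemma ex_stop i (g : cell -> bool * (cell * move)) Z z z' : small Z ->
  ~~ (g (read_cell z)).1 -> act_cell z (g (read_cell z)).2 = z' ->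
  size z'.1 < s ->
  ex (While (tape_prim i g) (halt true)) (upd Z i z) false (upd Z i z').
Proof.
move=> sz /negPf gf E lt; have := @ex_tape i g Z z sz; rewrite /= E gf => /(_ lt).
exact: ExecStop.
Qed.

Lemma ex_step_right i Z l c r : small Z -> (size l).+1 < s ->
  ex (step_right i) (upd Z i (l, c :: r)) true (upd Z i (c :: l, r)).
Proof. exact: (@ex_tape i (fun c => (true, (c, MoveRight))) Z (l, c :: r)). Qed.

Lemma ex_rewind i Z l r : small Z -> (size l).+1 < s ->
  ex (rewind i) (upd Z i (rcons (map bit l) mark, map bit r)) false
     (upd Z i ([::], mark :: map bit (rev l ++ r))).
Proof.
move=> sz; elim: l r => [|b l IH] r lt.
  have s0 : 0 < s by apply: leq_ltn_trans lt.
  apply: (ex_round (z' := ([::], mark :: map bit r))) => //.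
  - by case: r => [|[] r].
  - by case: r => [|[] r].
  by apply: ex_stop.
have e := IH (b :: r) (ltnW lt).
rewrite rev_cons cat_rcons; apply: ex_round e => //; try by case: r => [|[] r].
by rewrite /= size_rcons size_map (ltnW lt).
Qed.

Lemma ex_erase i Z l r : small Z -> (size l).+1 < s -> size r <= 1 ->
  ex (erase i) (upd Z i (rcons (map bit l) mark, map bit r)) false
     (upd Z i ([::], [:: mark])).
Proof.
move=> sz; elim: l r => [|b l IH] r lt r1.
  have s0 : 0 < s by apply: leq_ltn_trans lt.
  apply: (ex_round (z' := ([::], [:: mark]))) => //; last by apply: ex_stop.
  - by case: r {r1} => [|[] r].
  - by case: r r1 => [|[] [|c r]].
have {IH} e := IH [:: b] (ltnW lt) isT.
apply: ex_round e => //; try by case: r r1 => [|[] [|c r]].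
by rewrite /= size_rcons size_map (ltnW lt).
Qed.

Lemma ex_to_blank i Z l r : small Z -> (size l + size r).+1 < s ->
  ex (to_blank i) (upd Z i (rcons (map bit l) mark, map bit r)) false
     (upd Z i (rcons (map bit (catrev r l)) mark, [::])).
Proof.
move=> sz; elim: r l => [|b r IH] l lt.
  by apply: ex_stop => //=; rewrite size_rcons size_map -[size l]addn0.
have {IH} e : ex (to_blank i)
    (upd Z i (rcons (map bit (b :: l)) mark, map bit r)) false
    (upd Z i (rcons (map bit (catrev (b :: r) l)) mark, [::])).
  by apply: IH; rewrite /= addSnnS.
apply: ex_round e => //.
rewrite /= size_rcons size_map; apply: leq_trans lt.
by rewrite /= addnS !ltnS leq_addr.
Qed.

(** The place where the carry stops is left open, because [rewind] follows and
    starts anywhere. *)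
Lemma ex_carry i Z l r : small Z -> (size l + size (bin_succ r)).+1 < s ->
  exists l' r', [/\ rev l' ++ r' = rev l ++ bin_succ r,
    size l' <= size l + size (bin_succ r) &
  ex (carry i) (upd Z i (rcons (map bit l) mark, map bit r)) false
     (upd Z i (rcons (map bit l') mark, map bit r'))].
Proof.
move=> sz; elim: r l => [|[] r IH] l lt.
- exists l, [:: true]; split=> //; first exact: leq_addr.
  apply: ex_stop => //=; rewrite size_rcons size_map.
  by apply: leq_ltn_trans lt; rewrite /= addn1.
- have [|l' [r' [E le e]]] := IH (false :: l); first by rewrite /= addSnnS.
  exists l', r'; split.
  + by rewrite E rev_cons cat_rcons.
  + by rewrite /= -addSnnS.
  apply: ex_round e => //=; rewrite size_rcons size_map.
  by apply: leq_ltn_trans lt; rewrite /= addnS !ltnS leq_addr.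
- exists l, (true :: r); split=> //; first exact: leq_addr.
  apply: ex_stop => //=; rewrite size_rcons size_map.
  by apply: leq_ltn_trans lt; rewrite ltnS leq_addr.
Qed.

Lemma ex_inc i Z n : small Z -> (size (bin n.+1)).+1 < s ->
  ex (inc_prog i) (upd Z i (counter n)) true (upd Z i (counter n.+1)).
Proof.
move=> sz lt; have s1 : 1 < s by apply: leq_ltn_trans lt.
have s0 := ltnW s1.
apply: ex_seq (ex_step_right _ _ _ _ _) _ => //.
have [|l' [r' [E le e]]] := @ex_carry i Z [::] (bin n) sz; first by [].
apply: ex_seq e _; apply: ex_seq (ex_rewind _ _ _ _) _ => //.
  by apply: leq_ltn_trans lt; rewrite ltnS.
by rewrite E; apply: ex_halt; apply: small_upd.
Qed.

Lemma ex_reset i Z n : small Z -> (size (bin n)).+1 < s ->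
  ex (reset_prog i) (upd Z i (counter n)) true (upd Z i (counter 0)).
Proof.
move=> sz lt; have s1 : 1 < s by apply: leq_ltn_trans lt.
have s0 := ltnW s1.
apply: ex_seq (ex_step_right _ _ _ _ _) _ => //.
apply: ex_seq (@ex_to_blank i Z [::] (bin n) sz lt) _.
apply: ex_seq (@ex_erase i Z _ [::] sz _ _) _ => //.
  by rewrite -[catrev _ _]/(rev _) size_rev.
by apply: ex_halt; apply: small_upd.
Qed.

(** The two heads advance as long as their digits agree; where they stop, the
    two cells under them tell whether the numbers are equal. *)
Lemma ex_eq_scan i j Z (l r r' : seq bool) : i != j -> small Z ->
  (size l + maxn (size r) (size r')).+1 < s ->
  let st l r r' := upd (upd Z i (rcons (map bit l) mark, map bit r))
                     j (rcons (map bit l) mark, map bit r') in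
  exists l1 r1 r1', [/\ rev l1 ++ r1 = rev l ++ r, rev l1 ++ r1' = rev l ++ r',
   (ohead r1 == ohead r1') = (r == r'),
   size l1 <= size l + maxn (size r) (size r') &
   ex (While (pure_test (fun _ y => (y i == y j) && (y i != None)))
               (seqp (step_right i) (step_right j)))
     (st l r r') false (st l1 r1 r1')].
Proof.
move=> ij sz + st.
have sti l0 r0 r0' : symbols (Memory pos (st l0 r0 r0') o) i = (omap Some (ohead r0) : cell).
  by rewrite ffunE /= /st /upd eqxx (negPf ij); case: r0.
have stj l0 r0 r0' : symbols (Memory pos (st l0 r0 r0') o) j = (omap Some (ohead r0') : cell).
  by rewrite ffunE /= /st /upd eqxx; case: r0'.
have small_st l0 r0 r0' : (size l0).+1 < s -> small (st l0 r0 r0').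
  by move=> lt; do 2?apply: small_upd => //=; rewrite size_rcons size_map.
have test l0 r0 r0' (lt : (size l0).+1 < s) :=
  @ex_test (fun _ y => (y i == y j) && (y i != None)) _ (small_st l0 r0 r0' lt).
have stop l0 r0 r0' : (size l0 + maxn (size r0) (size r0')).+1 < s ->
  (ohead r0 == ohead r0') && (r0 != [::]) = false -> 
  (ohead r0 == ohead r0') = (r0 == r0') ->
  exists l1 r1 r1', [/\ rev l1 ++ r1 = rev l0 ++ r0, rev l1 ++ r1' = rev l0 ++ r0',
   (ohead r1 == ohead r1') = (r0 == r0'),
   size l1 <= size l0 + maxn (size r0) (size r0') &
   ex (While (pure_test (fun _ y => (y i == y j) && (y i != None)))
               (seqp (step_right i) (step_right j)))
     (st l0 r0 r0') false (st l1 r1 r1')].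
  move=> lt hd E; exists l0, r0, r0'; split=> //; first exact: leq_addr.
  have lt1 : (size l0).+1 < s by apply: leq_ltn_trans lt; rewrite ltnS leq_addr.
  have := test l0 r0 r0' lt1.
  rewrite sti stj; have -> : ((omap Some (ohead r0) : cell) ==
     (omap Some (ohead r0') : cell)) && ((omap Some (ohead r0) : cell) != None) = false.
    rewrite -hd; case: (r0) => [|b r1]; case: (r0') => [|b' r1'] //=.
  exact: ExecStop.
elim: r l r' => [|b r IH] l [|b' r'] lt.
- exact: stop.
- exact: stop.
- exact: stop.
case: (eqVneq b b') => [Eb|nb]; last first.
  apply: stop => //=; first by apply/negbTE; rewrite andbT; apply: contra nb => /eqP[->].
  by rewrite eqseq_cons (negPf nb); apply/negbTE; apply: contra nb => /eqP[->].
have [|l1 [r1 [r1' [E1 E2 E3 le e]]]] := IH (b :: l) r'.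
  by move: lt; rewrite /= maxnSS addnS addSn.
have lt1 : (size l).+2 < s.
  move: lt; rewrite /= maxnSS addnS; apply: leq_ltn_trans.
  by rewrite !ltnS leq_addr.
exists l1, r1, r1'; split.
- by rewrite E1 rev_cons cat_rcons.
- by rewrite E2 rev_cons cat_rcons Eb.
- by rewrite E3 eqseq_cons Eb eqxx.
- by apply: leq_trans le _; rewrite /= maxnSS addnS addSn.
have := test l (b :: r) (b' :: r') (ltnW lt1).
rewrite sti stj /= Eb eqxx /= => t; apply: ExecLoop t _ e.
apply: (ex_seq (Z' := upd (upd Z i (bit b :: rcons (map bit l) mark, map bit r)) j
                     (rcons (map bit l) mark, map bit (b' :: r')))).
  rewrite /st updC // Eb [X in ex _ _ _ X]updC //.
  apply: ex_step_right; last by rewrite size_rcons size_map.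
  by apply: small_upd => //=; rewrite size_rcons size_map ltnW.
rewrite /st /= Eb; apply: ex_step_right; last by rewrite size_rcons size_map.
by apply: small_upd => //=; rewrite size_rcons size_map.
Qed.

Lemma ex_eq i j Z m n : small Z ->
  Z i = counter m -> Z j = counter n ->
  (maxn (size (bin m)) (size (bin n))).+1 < s ->
  ex (eq_prog i j) Z (m == n) Z.
Proof.
move=> sz Zi Zj lt; have s1 : 1 < s by apply: leq_ltn_trans lt.
have s0 := ltnW s1.
rewrite /eq_prog; case: (eqVneq i j) => [ij|ij].
  have -> : m = n by apply: (can_inj binK); move: Zi; rewrite ij Zj => -[/inj_map-> // ? ? []].
  by rewrite eqxx; apply: ex_halt.
pose st l r r' := upd (upd Z i (rcons (map bit l) mark, map bit r))
                     j (rcons (map bit l) mark, map bit r').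
have Zst : Z = upd (upd Z i (counter m)) j (counter n).
  by rewrite -Zi upd_id -Zj upd_id.
apply: (ex_seq (Z' := st [::] (bin m) (bin n)) (b := true)).
  apply: (ex_seq (Z' := upd (upd Z i ([:: mark], map bit (bin m))) j (counter n)) (b := true)).
    rewrite [X in ex _ X _ _]Zst updC // [X in ex _ _ _ X]updC //.
    by apply: ex_step_right => //; apply: small_upd.
  by apply: ex_step_right => //; apply: small_upd.
have [|l1 [r1 [r1' [E1 E2 E3 le e]]]] := @ex_eq_scan i j Z [::] (bin m) (bin n) ij sz.
  by [].
have lt1 : (size l1).+1 < s by apply: leq_ltn_trans lt; rewrite ltnS.
apply: ex_seq e _.
have mn : (bin m == bin n) = (m == n) by rewrite (can_eq binK).
have sz1 : small (upd (upd Z i (rcons (map bit l1) mark, (map bit r1))) j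
       (rcons (map bit l1) mark, (map bit r1'))).
  by do 2?apply: small_upd => //=; rewrite size_rcons size_map.
apply: ExecIf (ex_test _ sz1) _.
set c := (X in if X then _ else _).
have -> : c = (m == n).
  rewrite /c !ffunE /upd /= !eqxx (negPf ij) -mn -E3.
  by case: (r1) => [|b r2]; case: (r1') => [|b' r2'].
have fin b : ex (seqp (rewind i) (seqp (rewind j) (halt b)))
   (upd (upd Z i (rcons (map bit l1) mark, (map bit r1))) j
       (rcons (map bit l1) mark, (map bit r1'))) b Z.
  apply: (ex_seq (Z' := upd (upd Z i (counter m)) j
       (rcons (map bit l1) mark, (map bit r1'))) (b := false)).
    rewrite updC // [X in ex _ _ _ X]updC // /counter -[bin m]E1.
    by apply: ex_rewind => //; apply: small_upd => //=; rewrite size_rcons size_map.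
  apply: (ex_seq (Z' := Z) (b := false)); last exact: ex_halt.
  rewrite [X in ex _ _ _ X]Zst /counter -[bin n]E2.
  by apply: ex_rewind => //; apply: small_upd.
by case: (m == n).
Qed.

End Correct.
End Compilation.

Section Simulation.
Variables (k : nat) (w : seq bool) (s : nat).
Hypothesis space : (trunc_log 2 (size w).+1).+2 < s.

Definition memory_of (x : rstate) : memory k.+1 :=
  Memory (ipos x) (fun i => counter (reg x i)) (out x).

Definition bounded (x : rstate) : Prop :=
  (forall i, reg x i <= (size w).+1) /\ ipos x <= (size w).+1.

Lemma rexec_bounded p x b y : rexec w p x b y -> bounded x -> bounded y.
Proof.
elim=> {p x b y} //=.
- by move=> i v p o vi [bv bp]; split=> //= j; case: eqP.
- by move=> i v p o [bv bp]; split=> //= j; case: eqP.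
- by move=> v p o [bv bp]; split=> //=; apply: leq_trans (leq_pred _) bp.
- by move=> v p o [bv bp]; split=> //=; apply: geq_minr.
- by move=> p q r x b x1 b' x2 _ IH1 _ IH2 /IH1/IH2.
- by move=> p q x x1 b x2 b' x3 _ IH1 _ IH2 _ IH3 /IH1/IH2/IH3.
Qed.

Lemma counter_space n : n <= (size w).+1 -> (size (bin n)).+1 < s.
Proof.
move=> le; apply: leq_ltn_trans space; rewrite ltnS.
by apply: leq_trans (size_bin n) _; rewrite ltnS leq_trunc_log.
Qed.

Lemma small_counters (v : nat -> nat) (i : 'I_k.+1) :
  size (counter (v i)).1 < s.
Proof. by apply: leq_ltn_trans space. Qed.

Lemma upd_counters (v : nat -> nat) i n : i <= k ->
  (fun j : 'I_k.+1 => counter ([eta v with i |-> n] j)) =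
  upd (fun j => counter (v j)) (inord i) (counter n).
Proof.
move=> ik; apply: functional_extensionality => j; rewrite /upd /=.
by rewrite -val_eqE /= inordK //; case: eqP.
Qed.

Lemma counters_upd (v : nat -> nat) i : i <= k ->
  (fun j : 'I_k.+1 => counter (v j)) =
  upd (fun j => counter (v j)) (inord i) (counter (v i)).
Proof.
move=> ik; apply: functional_extensionality => j; rewrite /upd /=.
by rewrite -val_eqE /= inordK //; case: eqP => [->|].
Qed.

Theorem rexec_exec p x b y : rexec w p x b y -> bounded x -> max_reg p <= k ->
  exec w s (compile k p) (memory_of x) b (memory_of y).
Proof.
elim=> {p x b y}; rewrite /memory_of /=.
- move=> i v p o vi [bv bp] ik; rewrite /= upd_counters // {1}(counters_upd _ ik).
  by apply: ex_inc => //; [exact: small_counters | exact: counter_space].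
- move=> i v p o [bv bp] ik; rewrite /= upd_counters // {1}(counters_upd _ ik).
  by apply: ex_reset => //; [exact: small_counters | exact: counter_space].
- move=> i j [v p o] [bv bp]; rewrite geq_max => /andP[ik jk] /=.
  apply: ex_eq => //=; rewrite ?inordK //; first exact: small_counters.
  by rewrite -maxnSS gtn_max !counter_space // bv.
- move=> v p o [bv bp] _.
  have := @ExecPrim _ w s (fun _ y => (true, (MoveLeft, @idle k y, None)))
    (Memory p (fun i => counter (v i)) o).
  rewrite /= /do_action /= idle_tapes (minn_idPl (leq_trans (leq_pred _) bp)).
  by apply; apply: small_counters.
- move=> v p o [bv bp] _.
  have := @ExecPrim _ w s (fun _ y => (true, (MoveRight, @idle k y, None)))
    (Memory p (fun i => counter (v i)) o).
  rewrite /= /do_action /= idle_tapes.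
  by apply; apply: small_counters.
- move=> f [v p o] [bv bp] _ /=.
  exact: (ex_test _ bp (fun x _ => f x) (small_counters v)).
- move=> c v p o [bv bp] _.
  have := @ExecPrim _ w s (fun _ y => (true, (Stay, @idle k y, Some c)))
    (Memory p (fun i => counter (v i)) o).
  rewrite /= /do_action /= idle_tapes (minn_idPl bp).
  by apply; apply: small_counters.
- move=> p q r x b x1 b' x2 e1 IH1 e2 IH2 bx; rewrite !geq_max => /and3P[kp kq kr].
  apply: ExecIf (IH1 bx kp) _.
  by have b1 := rexec_bounded e1 bx; move: IH2; case: (b) => IH2; apply: IH2.
- by move=> p q x y e IH bx; rewrite geq_max => /andP[kp kq]; apply: ExecStop; apply: IH.
- move=> p q x x1 b x2 b' x3 e1 IH1 e2 IH2 e3 IH3 bx kpq.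
  have /andP[kp kq] : (max_reg p <= k) && (max_reg q <= k) by rewrite -geq_max.
  have b1 := rexec_bounded e1 bx; have b2 := rexec_bounded e2 b1.
  by apply: ExecLoop (IH1 bx kp) (IH2 b1 kq) (IH3 b2 kpq).
Qed.

End Simulation.

Definition start_state : rstate := RState (fun=> 0) 0 [::].

(** A counter takes one cell for each of its at most [log (size w) + 2] digits
    and one for the mark. *)
Theorem logspace_computable_rprog tau sigma
    (f : structure tau -> structure sigma) p :
  (forall A, exists b x,
     rexec (encode A) p start_state b x /\ out x = encode (f A)) ->
  logspace_computable f.
Proof.
move=> Hp; pose k := max_reg p.
pose ini : prog k.+1 :=
  Prim (fun _ y => (true, (Stay, (fun=> (mark, Stay)), None))).
exists (machine (seqp ini (compile k p))), 4 => A.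
have [b [x [ex <-]]] := Hp A; set w := encode A in ex *.
have w1 : 0 < size w by rewrite /w /encode size_cat /= addnS.
(* The last cell a head visits is at most log (size w) + 3. *)
pose s := 4 * (trunc_log 2 (size w)).+1.
have space : (trunc_log 2 (size w).+1).+2 < s.
  have le : trunc_log 2 (size w).+1 <= (trunc_log 2 (size w)).+1.
    rewrite -trunc_log2_double // leq_trunc_log //.
    by rewrite -addnn -addn1 leq_add2l.
  apply: (@leq_ltn_trans (trunc_log 2 (size w)).+3); first by rewrite !ltnS.
  by rewrite /s mulnS -[_.+4]/(4 + _) leq_add2l leq_pmull.
apply: (@exec_machine _ w s (seqp ini (compile k p)) b (memory_of k x)).
  by apply: leq_ltn_trans space.
have st : exec w s ini (Memory 0 (fun=> ([::], [::])) [::]) true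
            (memory_of k start_state).
  have := @ExecPrim _ w s (fun _ y => (true, (Stay, (fun=> (mark, Stay)), None)))
    (Memory 0 (fun=> ([::], [::])) [::] : memory k.+1).
  by apply=> i; apply: leq_ltn_trans space.
apply: ExecIf st _; apply: rexec_exec ex _ _ => //; split=> //.
Qed.


(** * Loops, comparisons and input look-up *)

Definition rdone (b : bool) : rprog := Read (fun=> b).
Definition rseq (p q : rprog) : rprog := RIf p q q.
Definition rnot (p : rprog) : rprog := RIf p (rdone false) (rdone true).
Definition rand (p q : rprog) : rprog := RIf p q (rdone false).

Definition for_loop (i r : nat) (body : rprog) : rprog :=
  rseq (Reset i) (RWhile (rnot (EqR i r)) (rseq body (Inc i))).

Definition copy (i r : nat) : rprog := for_loop i r (rdone true).

Definition not_left (x : input_symbol) : bool :=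
  if x is LeftEnd then false else true.

Definition rewind_input : rprog := RWhile (Read not_left) InL.

(** Moves the input head right by [n ^ e], where register 0 holds [n], with
    nested loops in the scratch registers from [m] on. *)
Fixpoint skip_power (e m : nat) : rprog :=
  if e is e'.+1 then for_loop m 0 (skip_power e' m.+1) else InR.

(** Moves the input head right by the rank, in lexicographic order, of the tuple
    in the registers [rs]. *)
Fixpoint skip_lex (rs : seq nat) (m : nat) : rprog :=
  if rs is r :: rs' then
    rseq (for_loop m r (skip_power (size rs') m.+1)) (skip_lex rs' m)
  else rdone true.

Definition skip_tables (sigma : signature) (Rs : seq (sym sigma)) (m : nat) :
    rprog :=
  foldr (fun R => rseq (skip_power (arity R) m)) (rdone true) Rs.

Definition tables_before (sigma : signature) (R : sym sigma) :=
  take (index R (enum (sym sigma))) (enum (sym sigma)).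

Definition goto_bit (sigma : signature) (R : sym sigma) (rs : seq nat)
    (m : nat) : rprog :=
  rseq rewind_input (rseq InR (rseq (for_loop m 0 InR) (rseq InR
    (rseq (skip_tables (tables_before R) m) (skip_lex rs m))))).

Definition is_one (x : input_symbol) : bool :=
  if x is InputBit b then b else false.

Definition lookup (sigma : signature) (R : sym sigma) rs m : rprog :=
  rseq (goto_bit R rs m) (Read is_one).

(** The position of the input head cannot be read off; it is counted while the
    head walks back to the left end. *)
Definition at_bit (sigma : signature) (R : sym sigma) rs i m : rprog :=
  rseq (goto_bit R rs m) (rseq InL (rseq (Reset m)
    (rseq (RWhile (Read not_left) (rseq InL (Inc m))) (EqR m i)))).

(** Counting up to whichever of two registers is reached first always ends, and
    tells how they compare. *)
Definition count_to_min i j m : rprog :=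
  rseq (Reset m) (RWhile (rand (rnot (EqR m i)) (rnot (EqR m j))) (Inc m)).

Definition le_prog i j m : rprog := rseq (count_to_min i j m) (EqR m i).

Definition succ_prog i j m : rprog :=
  rseq (count_to_min i j m)
    (RIf (EqR m j) (rdone false) (rseq (Inc m) (EqR m j))).

Fixpoint lex_index (n : nat) (u : seq nat) : nat :=
  if u is x :: u' then x * n ^ size u' + lex_index n u' else 0.

Definition table_offset (sigma : signature) (n : nat) (R : sym sigma) : nat :=
  sumn [seq n ^ arity Q | Q <- tables_before R].

(** The position, from 0, of the bit of [R] at the tuple [u] in an encoding with a
    domain of size [n]: it is preceded by the size in unary, a separator, and the
    tables of the earlier symbols. *)
Definition bit_index (sigma : signature) (n : nat) (R : sym sigma) u : nat :=
  n.+1 + table_offset n R + lex_index n u.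

Definition set_reg (i n : nat) (x : rstate) : rstate :=
  RState [eta reg x with i |-> n] (ipos x) (out x).

(** Specifications speak of the first [m] registers; the registers from [m] on
    are scratch space, whose contents a program may destroy. *)
Definition env (m : nat) (x : rstate) : seq nat := mkseq (reg x) m.

Lemma envP m x y : (forall j, j < m -> reg y j = reg x j) <-> env m y = env m x.
Proof.
split=> [E|E j jm].
  by apply: (@eq_from_nth _ 0); rewrite ?size_mkseq // => j jm; rewrite !nth_mkseq ?E.
by have := congr1 (fun s => nth 0 s j) E; rewrite !nth_mkseq.
Qed.

Lemma envS m x : env m.+1 x = rcons (env m x) (reg x m).
Proof. exact: mkseqS. Qed.

Lemma nth_env m x j : j < m -> nth 0 (env m x) j = reg x j.
Proof. exact: nth_mkseq. Qed.

Lemma env_set m n x : env m (set_reg m n x) = env m x.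
Proof. by apply/envP => j jm /=; rewrite ltn_eqF. Qed.

Lemma env_weaken m x y : env m.+1 y = env m.+1 x -> env m y = env m x.
Proof. by rewrite !envS => /rcons_inj[]. Qed.

Section Runs.
Variable w : seq bool.
Local Notation run := (rexec w).

Lemma run_done b x : run (rdone b) x b x.
Proof. exact: RxRead. Qed.

Lemma run_seq p q x b y b' z : run p x b y -> run q y b' z ->
  run (rseq p q) x b' z.
Proof. by move=> e1 e2; apply: RxIf e1 _; case: b. Qed.

Lemma run_not p x b y : run p x b y -> run (rnot p) x (~~ b) y.
Proof. by move=> e; apply: RxIf e _; case: b; apply: run_done. Qed.

Lemma run_reset i x : run (Reset i) x true (set_reg i 0 x).
Proof. by case: x => v p o; apply: RxReset. Qed.

Lemma run_inc i x : reg x i <= size w ->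
  run (Inc i) x true (set_reg i (reg x i).+1 x).
Proof. by case: x => v p o; apply: RxInc. Qed.

Lemma bounded_set i n x : n <= (size w).+1 -> bounded w x ->
  bounded w (set_reg i n x).
Proof. by move=> le [bv bp]; split=> //= j; case: eqP. Qed.

(** The invariant is stated for the moment after the counter is set, so that it
    holds when the body is entered. *)
Lemma for_rule i r body (I : nat -> rstate -> Prop) c x :
  i != r -> bounded w x -> reg x r = c -> I 0 (set_reg i 0 x) ->
  (forall j y, j < c -> I j y -> bounded w y -> reg y i = j -> reg y r = c ->
     exists b z, [/\ run body y b z, reg z i = j, reg z r = c &
                  I j.+1 (set_reg i j.+1 z)]) ->
  exists z, [/\ run (for_loop i r body) x false z, I c z, reg z i = c & reg z r = c].
Proof.
move=> ir bx xr I0 Istep.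
have ri : r == i = false by rewrite eq_sym (negPf ir).
have loop d j y : j + d = c -> I j y -> bounded w y -> reg y i = j ->
    reg y r = c -> exists z,
    [/\ run (RWhile (rnot (EqR i r)) (rseq body (Inc i))) y false z, I c z,
        reg z i = c & reg z r = c].
  elim: d j y => [|d IH] j y jd Ij by' yi yr.
    exists y; rewrite addn0 in jd; rewrite jd in Ij yi.
    split=> //; apply: RxStop.
    by have := run_not (RxEq w i r y); rewrite yi yr eqxx.
  have jc : j < c by rewrite -jd addnS ltnS leq_addr.
  have [b [z [rz zi zr Iz]]] := Istep j y jc Ij by' yi yr.
  have cw : c <= (size w).+1 by rewrite -yr; case: by'.
  have jw : j <= size w by rewrite -ltnS; apply: leq_trans jc cw.
  have bz := rexec_bounded rz by'.
  have [] := IH j.+1 (set_reg i j.+1 z) _ Iz _ _ _.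
  - by rewrite addSnnS.
  - exact: bounded_set.
  - by rewrite /= eqxx.
  - by rewrite /= ri.
  move=> z' [rz' Iz' zi' zr']; exists z'; split=> //.
  apply: RxLoop rz'.
    have := run_not (RxEq w i r y); rewrite yi yr (ltn_eqF jc). exact.
  by apply: run_seq rz _; rewrite -{2}zi; apply: run_inc; rewrite zi.
have [|//||||z [rz Iz zi zr]] := loop c 0 (set_reg i 0 x).
- by [].
- exact: bounded_set.
- by rewrite /= eqxx.
- by rewrite /= ri.
by exists z; split=> //; apply: run_seq (run_reset i x) rz.
Qed.

Lemma run_copy i r x : i != r -> bounded w x -> exists y,
  [/\ run (copy i r) x false y, reg y i = reg x r,
      forall j, j != i -> reg y j = reg x j, ipos y = ipos x & out y = out x].
Proof.
move=> ir bx.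
have [|j y jc [P1 P2 P3] by' yi yr|y [ry [P1 P2 P3] yi yr]] :=
  @for_rule i r (rdone true) (fun _ y => [/\ forall j, j != i -> reg y j = reg x j,
    ipos y = ipos x & out y = out x]) _ x ir bx (erefl _).
- by split=> //= j /negPf->.
- exists true, y; split=> //; first exact: run_done.
  by split=> //= l li; rewrite (negPf li) P1.
by exists y.
Qed.

Lemma run_left x :
  run InL x true (RState (reg x) (ipos x).-1 (out x)).
Proof. by case: x => *; apply: RxL. Qed.

Lemma run_right x :
  run InR x true (RState (reg x) (minn (ipos x).+1 (size w).+1) (out x)).
Proof. by case: x => *; apply: RxR. Qed.

Lemma not_left_at p : not_left (input_at w p) = (0 < p).
Proof. by case: p => //= p; case: ifP. Qed.

(** Behind the input the head rests on the end marker, which counts as a zero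
    just like the default of [nth]. *)
Lemma is_one_at p : is_one (input_at w (minn p.+1 (size w).+1)) = nth false w p.
Proof.
rewrite minnSS /=; case: (ltnP p (size w)) => [lt|le].
  by rewrite lt.
by rewrite ltnn nth_default.
Qed.

Lemma run_rewind x :
  run rewind_input x false (RState (reg x) 0 (out x)).
Proof.
case: x => v p o /=; elim: p => [|p IH].
  by apply: RxStop; apply: (RxRead w not_left).
have := RxRead w not_left (RState v p.+1 o); rewrite not_left_at => /= t.
exact: RxLoop t (run_left (RState v p.+1 o)) IH.
Qed.

Variable n : nat.

(** Registers 0 and 1 keep the size of the domain and the length of the input. *)
Definition based x := [/\ bounded w x, reg x 0 = n & reg x 1 = size w].

Lemma based_run m p x b y : 1 < m -> run p x b y -> env m y = env m x ->
  based x -> based y.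
Proof.
move=> m1 r /envP E [bx x0 x1]; split; first exact: rexec_bounded r bx.
  by rewrite E // ltnW.
by rewrite E.
Qed.

(** The input head stops at the right end marker; building this into the
    specification spares all side conditions on the contents of registers. *)
Definition moves m p (K : seq nat -> nat) := forall x, based x ->
  exists b y, [/\ run p x b y, env m y = env m x, out y = out x &
    ipos y = minn (ipos x + K (env m x)) (size w).+1].

Lemma eq_moves m p K L : K =1 L -> moves m p K -> moves m p L.
Proof. by move=> E H x /H; rewrite -E. Qed.

Lemma moves_right m : moves m InR (fun=> 1).
Proof.
move=> x bx; exists true, (RState (reg x) (minn (ipos x).+1 (size w).+1) (out x)).
by split; first exact: run_right; rewrite //= addn1.
Qed.

Lemma moves_done m : moves m (rdone true) (fun=> 0).
Proof.
move=> x [[bv bp] _ _]; exists true, x; split=> //; first exact: run_done.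
by rewrite addn0 (minn_idPl bp).
Qed.

Lemma moves_seq m p q K L : 1 < m -> moves m p K -> moves m q L ->
  moves m (rseq p q) (fun e => K e + L e).
Proof.
move=> m1 Hp Hq x bx; have [b [y [ry Ey oy py]]] := Hp x bx.
have [b' [z [rz Ez oz pz]]] := Hq y (based_run m1 ry Ey bx).
exists b', z; split; first exact: run_seq ry rz.
- by rewrite Ez.
- by rewrite oz.
rewrite pz py Ey addn_minl -minnA (minn_idPr (leq_addr _ _)).
by rewrite addnA.
Qed.

Lemma moves_for m r body k : 1 < m -> r < m -> moves m.+1 body (fun=> k) ->
  moves m (for_loop m r body) (fun e => nth 0 e r * k).
Proof.
move=> m1 rm Hb x bsx; have [bx x0 x1] := bsx.
rewrite nth_env //.
have mr : m != r by rewrite gtn_eqF.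
have [|j y jc [P1 P2 P3] by' yi yr|y [ry [P1 P2 P3] yi yr]] :=
  @for_rule m r body (fun j y => [/\ env m y = env m x,
    ipos y = minn (ipos x + j * k) (size w).+1 & out y = out x]) _ x mr bx (erefl _).
- by rewrite env_set /= addn0 (minn_idPl _) //; case: bx.
- have bsy : based y.
    by split=> //; move/envP: P1 => P1; rewrite P1 // ltnW.
  have [b [z [rz Ez oz pz]]] := Hb y bsy.
  have := Ez; rewrite !envS => /rcons_inj[Ez' zm].
  exists b, z; split=> //; first by rewrite zm.
    by have /envP := Ez => ->; rewrite // ltnW.
  rewrite env_set /= oz pz Ez' P1 P2; split=> //.
  by rewrite addn_minl -minnA (minn_idPr (leq_addr _ _)) -addnA mulSnr.
by exists false, y.
Qed.

Lemma moves_power m e : 1 < m -> moves m (skip_power e m) (fun=> n ^ e).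
Proof.
elim: e m => [|e IH] m m1; first exact: moves_right.
move=> x bx.
have [b [y [ry Ey oy py]]] :=
  moves_for m1 (ltnW m1) (IH m.+1 (ltnW m1)) bx.
exists b, y; split=> //; rewrite py nth_env ?(ltnW m1) //.
by case: bx => _ -> _; rewrite expnS.
Qed.

Lemma moves_lex m rs : 1 < m -> all (gtn m) rs ->
  moves m (skip_lex rs m) (fun e => lex_index n [seq nth 0 e r | r <- rs]).
Proof.
move=> m1; elim: rs => [_|r rs IH /= /andP[rm /IH{}IH]]; first exact: moves_done.
have := moves_seq m1 (moves_for m1 rm (@moves_power m.+1 (size rs) (ltnW m1))) IH.
by apply: eq_moves => e; rewrite size_map.
Qed.

Lemma moves_tables (sigma : signature) (Rs : seq (sym sigma)) m : 1 < m ->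
  moves m (skip_tables Rs m) (fun=> sumn [seq n ^ arity R | R <- Rs]).
Proof.
move=> m1; elim: Rs => [|R Rs IH] /=; first exact: moves_done.
exact: moves_seq m1 (moves_power _ m1) IH.
Qed.

Lemma run_goto (sigma : signature) (R : sym sigma) rs m x :
  1 < m -> all (gtn m) rs -> based x -> exists b y,
  [/\ run (goto_bit R rs m) x b y, env m y = env m x, out y = out x &
   ipos y = minn (bit_index n R [seq nth 0 (env m x) r | r <- rs]).+1
                 (size w).+1].
Proof.
move=> m1 rsm bx; have [[bv bp] x0 x1] := bx.
set x' := RState (reg x) 0 (out x).
have bx' : based x' by split.
have m0 := ltnW m1.
have := moves_seq m1 (@moves_right m) (moves_seq m1
  (moves_for m1 m0 (@moves_right m.+1)) (moves_seq m1 (@moves_right m)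
  (moves_seq m1 (moves_tables (tables_before R) m1) (moves_lex m1 rsm)))).
case/(_ _ bx') => b [y [ry Ey oy py]].
exists b, y; split=> //; first exact: run_seq (run_rewind x) ry.
rewrite py; congr minn; rewrite /= nth_env //= x0 muln1 add0n !add1n !addnS.
by rewrite /bit_index /table_offset addSn addnA.
Qed.

End Runs.


(** * Encodings as tables indexed by numbers *)

(** Relations on plain sequences: two symbols whose arities are equal but not
    convertible can then be compared without casts. *)
Definition holds (sigma : signature) (A : structure sigma) (R : sym sigma)
    (u : seq (dom A)) : bool :=
  if insub u is Some t then t \in interp A R else false.

Lemma holds_tuple (sigma : signature) (A : structure sigma) (R : sym sigma)
    (t : (arity R).-tuple (dom A)) : holds R t = (t \in interp A R).
Proof. by rewrite /holds valK. Qed.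

Lemma holds_size (sigma : signature) (A : structure sigma) (R : sym sigma)
    (u : seq (dom A)) : holds R u -> size u = arity R.
Proof. by rewrite /holds; case: insubP => //= t _ <- _; rewrite size_tuple. Qed.

Fixpoint lex_seqs (T : Type) (L : seq T) (r : nat) : seq (seq T) :=
  if r is r'.+1 then [seq x :: u | x <- L, u <- lex_seqs L r'] else [:: [::]].

Lemma size_lex_seqs (T : Type) (L : seq T) r : size (lex_seqs L r) = size L ^ r.
Proof. by elim: r => //= r IH; rewrite size_allpairs IH expnS. Qed.

Lemma map_lex_seqs (T U : Type) (f : T -> U) (L : seq T) r :
  lex_seqs (map f L) r = [seq map f u | u <- lex_seqs L r].
Proof.
elim: r => //= r ->; rewrite map_allpairs allpairs_mapl allpairs_mapr.
by [].
Qed.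

Lemma lex_tuples_val (T : finType) r :
  [seq tval t | t <- lex_tuples T r] = lex_seqs (enum T) r.
Proof.
elim: r => //= r <-; rewrite map_allpairs allpairs_mapr.
by [].
Qed.

Lemma nth_flatten_index (T : Type) (x0 : T) ss i k :
  k < size (nth [::] ss i) ->
  nth x0 (flatten ss) (sumn (take i (shape ss)) + k) = nth x0 (nth [::] ss i) k.
Proof.
move=> kl; have kl' : k < nth 0 (shape ss) i.
  rewrite /shape; case: (ltnP i (size ss)) => [lt|le].
    by rewrite (nth_map [::]).
  by rewrite nth_default in kl.
by rewrite nth_flatten -/(flatten_index _ _ _) flatten_indexKl // flatten_indexKr.
Qed.

Lemma lex_index_lt n u : all (gtn n) u -> lex_index n u < n ^ size u.
Proof.
elim: u => //= x u IH /andP[xn /IH lt]; rewrite expnS.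
apply: (@leq_trans (x.+1 * n ^ size u)); last by rewrite leq_mul2r xn orbT.
by rewrite mulSnr ltn_add2l.
Qed.

Lemma nth_lex_seqs (T : Type) (x0 : T) (F : seq nat -> T) n u :
  all (gtn n) u ->
  nth x0 (map F (lex_seqs (iota 0 n) (size u))) (lex_index n u) = F u.
Proof.
elim: u F => [|x u IH] F //= /andP[xn un].
rewrite map_allpairs.
have E : sumn (take x (shape [seq [seq F (y :: v) | v <- lex_seqs (iota 0 n) (size u)] | y <- iota 0 n]))
         = x * n ^ size u.
  rewrite /shape -map_comp (eq_map (g := fun=> n ^ size u)); last first.
    by move=> y /=; rewrite size_map size_lex_seqs size_iota.
  rewrite -map_take take_iota (minn_idPl (ltnW xn)).
  by elim: (x) 0 => //= y IHy m; rewrite IHy mulSn.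
rewrite -E nth_flatten_index (nth_map 0) ?size_iota ?nth_iota //.
  exact: (IH (fun v => F (x :: v))).
by rewrite size_map size_lex_seqs size_iota lex_index_lt.
Qed.

(** The values of [F] may be of any type: with pairs as values, the table lists
    the symbols and tuples themselves, which serves to study positions. *)
Definition tables (sigma : signature) (T : Type) (L : seq nat)
    (F : sym sigma -> seq nat -> T) : seq T :=
  flatten [seq [seq F R u | u <- lex_seqs L (arity R)] | R <- enum (sym sigma)].

Lemma size_tables (sigma : signature) (T : Type) (L : seq nat)
    (F : sym sigma -> seq nat -> T) :
  size (tables L F) = sumn [seq size L ^ arity R | R <- enum (sym sigma)].
Proof.
rewrite /tables size_flatten /shape -map_comp; congr sumn; apply: eq_map => R /=.
by rewrite size_map size_lex_seqs.
Qed.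

Lemma nth_tables (sigma : signature) (T : Type) (x0 : T) n
    (F : sym sigma -> seq nat -> T) (R : sym sigma) u :
  size u = arity R -> all (gtn n) u ->
  nth x0 (tables (iota 0 n) F) (table_offset n R + lex_index n u) = F R u.
Proof.
move=> su un; rewrite /tables /table_offset /tables_before.
have iR : index R (enum (sym sigma)) < size (enum (sym sigma)).
  by rewrite index_mem mem_enum.
set i := index R _ in iR *; set ss := map _ (enum (sym sigma)).
have -> : [seq n ^ arity Q | Q <- take i (enum (sym sigma))] = take i (shape ss).
  rewrite map_take /ss /shape -map_comp; congr take; apply: eq_map => Q /=.
  by rewrite size_map size_lex_seqs size_iota.
have nR : nth [::] ss i = [seq F R u | u <- lex_seqs (iota 0 n) (arity R)].
  by rewrite /ss (nth_map R) // nth_index // mem_enum.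
rewrite nth_flatten_index nR -su; first exact: nth_lex_seqs.
by rewrite size_map size_lex_seqs size_iota lex_index_lt.
Qed.

Section Encoding.
Variables (sigma : signature) (A : structure sigma).
Local Notation n := #|dom A|.

Definition elem0 : dom A := enum_val (Ordinal (dom_gt0 A)).

Definition elem (i : nat) : dom A := nth elem0 (enum (dom A)) i.

Definition code (a : dom A) : nat := enum_rank a.

Lemma codeK : cancel code elem.
Proof. by move=> a; rewrite /elem /code -[in RHS](enum_rankK a) (enum_val_nth elem0). Qed.

Lemma elemK i : i < n -> code (elem i) = i.
Proof.
by move=> lt; rewrite /elem /code -(enum_val_nth _ (Ordinal lt)) enum_valK.
Qed.

Lemma code_lt a : code a < n.
Proof. exact: ltn_ord. Qed.

Lemma code_inj : injective code.
Proof. exact: can_inj codeK. Qed.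

Lemma enum_elem : enum (dom A) = map elem (iota 0 n).
Proof.
rewrite cardE; apply: (@eq_from_nth _ elem0); first by rewrite size_map size_iota.
by move=> i lt; rewrite (nth_map 0) ?size_iota // nth_iota.
Qed.

Lemma encode_tables :
  encode A = nseq n true ++ false ::
             tables (iota 0 n) (fun R u => holds R (map elem u)).
Proof.
rewrite /encode /tables; congr (_ ++ _ :: flatten _).
apply: eq_map => R; rewrite (map_comp (fun v => holds R v) (map elem)) -map_lex_seqs -enum_elem.
rewrite -lex_tuples_val -map_comp; apply: eq_map => t /=.
by rewrite holds_tuple.
Qed.

Lemma encode_bit (R : sym sigma) u : size u = arity R -> all (gtn n) u ->
  nth false (encode A) (bit_index n R u) = holds R (map elem u).
Proof.
move=> su un; rewrite encode_tables /bit_index nth_cat size_nseq.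
rewrite -addnA addSnnS ltnNge leq_addr /= addKn /=.
exact: (nth_tables _ (fun R u => holds R (map elem u))).
Qed.

(** In a table without the entry [None], a position where [None] is read lies
    outside. *)
Lemma bit_index_lt (R : sym sigma) u : size u = arity R -> all (gtn n) u ->
  bit_index n R u < size (encode A).
Proof.
move=> su un; rewrite encode_tables size_cat size_nseq /= /bit_index.
rewrite !addSn addnS ltnS -addnA ltn_add2l ltnNge; apply/negP => le.
have := nth_tables None (fun (Q : sym sigma) v => Some (Q, v)) su un.
by rewrite nth_default //; move: le; rewrite !size_tables.
Qed.

End Encoding.

(** The table of all pairs of a symbol and a tuple, read at the common position,
    returns both pairs. *)
Lemma bit_index_inj (sigma : signature) n (R Q : sym sigma) u v :
  size u = arity R -> all (gtn n) u -> size v = arity Q -> all (gtn n) v ->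
  bit_index n R u = bit_index n Q v -> R = Q /\ u = v.
Proof.
move=> su un sv vn /eqP; rewrite /bit_index -!addnA eqn_add2l => /eqP E.
have := nth_tables None (fun (Q : sym sigma) v => Some (Q, v)) su un.
by rewrite E nth_tables // => -[-> ->].
Qed.

Lemma bit_index_ge (sigma : signature) n (R : sym sigma) u : n < bit_index n R u.
Proof. by rewrite /bit_index -addnA leq_addr. Qed.

(** The carrier is a type of ordinals, because an encoding follows [enum], which
    lists ordinals in their natural order. *)
Section Tabulated.
Variables (sigma : signature) (L : seq nat) (L0 : 0 < size L).
Variable F : sym sigma -> seq nat -> bool.

Lemma tabulated_gt0 : 0 < #|{: 'I_(size L)}|.
Proof. by rewrite card_ord. Qed.

Definition tabulated : structure sigma :=
  @Structure sigma 'I_(size L) tabulated_gt0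
    (fun R => [set t : (arity R).-tuple 'I_(size L) |
               F R [seq nth 0 L (val i) | i <- t]]).

Lemma holds_tabulated R (u : seq (dom tabulated)) :
  holds R u = (size u == arity R) && F R [seq nth 0 L (val i) | i <- u].
Proof.
rewrite /holds; case: insubP => [t /= st ut|/negPf->] //=.
by rewrite inE ut st.
Qed.

Lemma encode_tabulated :
  encode tabulated = nseq (size L) true ++ false :: tables L F.
Proof.
rewrite /encode /tables card_ord; congr (_ ++ _ :: flatten _).
apply: eq_map => R; have E : L = [seq nth 0 L (val i) | i : 'I_(size L)].
  rewrite /image_mem (map_comp (nth 0 L) val) val_enum_ord.
  by rewrite map_nth_iota0 // take_size.
rewrite [in RHS]E /image_mem map_lex_seqs -lex_tuples_val -!map_comp.
by apply: eq_map => t /=; rewrite inE.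
Qed.

End Tabulated.


(** * Tests and output loops *)

Section Tests.
Variables (w : seq bool) (n : nat).
Local Notation run := (rexec w).
Local Notation based := (based w n).

(** The registers from 2 to [m - 1] are variables with values below [c]. *)
Definition ready c m x := based x /\ forall j, 1 < j < m -> reg x j < c.

Definition test c m p (P : seq nat -> bool) := forall x, ready c m x ->
  exists y, [/\ run p x (P (env m x)) y, env m y = env m x & out y = out x].

Definition emits c m p (U : seq nat -> seq bool) := forall x, ready c m x ->
  exists b y, [/\ run p x b y, env m y = env m x & out y = out x ++ U (env m x)].

Lemma ready_run c m p x b y : 1 < m -> run p x b y -> env m y = env m x ->
  ready c m x -> ready c m y.
Proof.
move=> m1 r E [bx xc]; split; first exact: based_run r E bx.
by move=> j /andP[j1 jm]; move/envP: E => ->//; apply: xc; rewrite j1.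
Qed.

(** Two properties have to agree only where a program is started: out of range,
    the programs compute something else than what is wanted. *)
Lemma eq_test c m p P Q : (forall x, ready c m x -> P (env m x) = Q (env m x)) ->
  test c m p P -> test c m p Q.
Proof. by move=> E H x r; rewrite -E //; apply: H. Qed.

Lemma test_done c m b : test c m (rdone b) (fun=> b).
Proof. by move=> x _; exists x; split=> //; apply: run_done. Qed.

Lemma test_not c m p P : test c m p P -> test c m (rnot p) (fun e => ~~ P e).
Proof.
by move=> H x /H[y [r E o]]; exists y; split=> //; apply: run_not r.
Qed.

Lemma test_if c m p q r P Q R : 1 < m ->
  test c m p P -> test c m q Q -> test c m r R ->
  test c m (RIf p q r) (fun e => if P e then Q e else R e).
Proof.
move=> m1 Hp Hq Hr x rx; have [y [ry Ey oy]] := Hp x rx.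
have ry' := ready_run m1 ry Ey rx.
case: (P _) ry => ry; [have [z [rz Ez oz]] := Hq y ry' | have [z [rz Ez oz]] := Hr y ry'];
  exists z; rewrite -Ey; split=> //; rewrite ?oz //; exact: RxIf ry _.
Qed.

Lemma test_and c m p q P Q : 1 < m ->
  test c m p P -> test c m q Q -> test c m (rand p q) (fun e => P e && Q e).
Proof.
move=> m1 Hp Hq; apply: eq_test (test_if m1 Hp Hq (@test_done c m false)).
by move=> x _ /=; case: (P _).
Qed.

Lemma test_lookup c m (sigma : signature) (R : sym sigma) rs :
  1 < m -> all (gtn m) rs ->
  test c m (lookup R rs m)
    (fun e => nth false w (bit_index n R [seq nth 0 e r | r <- rs])).
Proof.
move=> m1 rsm x [bx _]; have [b [y [ry Ey oy py]]] := run_goto R m1 rsm bx.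
exists y; split=> //; apply: run_seq ry _.
by have := RxRead w is_one y; rewrite py is_one_at.
Qed.

Lemma run_position m x : based x -> 1 < m -> exists b y,
  [/\ run (RWhile (Read not_left) (rseq InL (Inc m))) (set_reg m 0 x) b y,
     env m y = env m x, out y = out x & reg y m = ipos x].
Proof.
move=> bx m1.
have loop p k y : ipos y = p -> reg y m = k -> p + k <= (size w).+1 ->
   exists z, [/\ run (RWhile (Read not_left) (rseq InL (Inc m))) y false z,
     env m z = env m y, out z = out y & reg z m = p + k].
  elim: p k y => [|p IH] k y yp yk le.
    exists y; split=> //; apply: RxStop.
    by have := RxRead w not_left y; rewrite yp.
  set y1 := RState (reg y) (ipos y).-1 (out y).
  have [|||z [rz Ez oz zm]] := IH k.+1 (set_reg m k.+1 y1).
  - by rewrite /= yp.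
  - by rewrite /= eqxx.
  - by rewrite addnS -addSn.
  exists z; split=> //; last by rewrite zm addnS.
    apply: RxLoop rz; first by have := RxRead w not_left y; rewrite not_left_at yp; exact.
    apply: run_seq (run_left w y) _; rewrite -/y1 -{2}yk.
    apply: run_inc; rewrite -ltnS yk; apply: leq_trans le.
    by rewrite addSn ltnS leq_addl.
  by rewrite Ez env_set.
have [|||z [rz Ez oz zm]] := loop (ipos x) 0 (set_reg m 0 x).
- by [].
- by rewrite /= eqxx.
- by rewrite addn0; case: bx => [[]].
by exists false, z; rewrite Ez env_set zm addn0.
Qed.

Lemma test_at c m (sigma : signature) (R : sym sigma) rs i :
  1 < i < m -> all (gtn m) rs -> c <= size w ->
  test c m (at_bit R rs i m)
    (fun e => bit_index n R [seq nth 0 e r | r <- rs] == nth 0 e i).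
Proof.
move=> /andP[i1 im] rsm cw x [bx xc]; have m1 := ltn_trans i1 im.
have [b [y [ry Ey oy py]]] := run_goto R m1 rsm bx.
set k := bit_index _ _ _ in py *.
set y1 := RState (reg y) (ipos y).-1 (out y).
have by1 : based y1.
  have [[bv bp] y0 y'1] := based_run m1 ry Ey bx.
  by split=> //; split=> //=; apply: leq_trans (leq_pred _) bp.
have [b' [z [rz Ez oz zm]]] := run_position by1 m1.
have Ezx : env m z = env m x by rewrite Ez.
have zi : reg z i = reg x i by move/envP: Ezx => ->.
exists z; split=> //; last by rewrite oz.
apply: run_seq ry _; apply: run_seq (run_left w y) _; rewrite -/y1.
apply: run_seq (run_reset w m y1) _; apply: run_seq rz _.
have := RxEq w m i z; rewrite zm zi /= py minnSS /= nth_env //.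
suff -> : (minn k (size w) == reg x i) = (k == reg x i) by [].
have xi : reg x i < size w by apply: leq_trans cw; apply: xc; rewrite i1.
case: (leqP k (size w)) => // lt.
by rewrite !gtn_eqF // (ltn_trans xi).
Qed.

Lemma run_count_to_min m i j x : 1 < m -> i < m -> j < m -> based x ->
  exists y, [/\ run (count_to_min i j m) x false y, env m y = env m x,
    out y = out x & reg y m = minn (reg x i) (reg x j)].
Proof.
move=> m1 im jm bx.
have loop d k y : k + d = minn (reg x i) (reg x j) -> reg y m = k ->
   env m y = env m x ->
   exists z, [/\ run (RWhile (rand (rnot (EqR m i)) (rnot (EqR m j))) (Inc m)) y
     false z, env m z = env m y, out z = out y & reg z m = k + d].
  elim: d k y => [|d IH] k y kd yk Ey; have /envP Exy := Ey;
    have t := RxIf (run_not (RxEq w m i y)) _; rewrite yk !Exy // in t.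
    exists y; split=> //; last by rewrite addn0.
    apply: RxStop; rewrite addn0 in kd.
    case: eqP t => [_|/eqP ki] t; first by apply: t; apply: run_done.
    apply: t; have := run_not (RxEq w m j y); rewrite yk Exy //.
    case: eqP => [//|/eqP kj]; move: ki kj; rewrite kd.
    by rewrite /minn; case: ifP; rewrite eqxx.
  have kmin : k < minn (reg x i) (reg x j) by rewrite -kd addnS ltnS leq_addr.
  have := kmin; rewrite leq_min => /andP[ki kj].
  have [|||z [rz Ez oz zm]] := IH k.+1 (set_reg m k.+1 y).
  - by rewrite addSnnS.
  - by rewrite /= eqxx.
  - by rewrite env_set.
  rewrite env_set in Ez.
  exists z; split=> //; last by rewrite zm addSnnS.
  apply: RxLoop rz.
    rewrite ltn_eqF // in t; apply: t.
    have := run_not (RxEq w m j y); rewrite yk Exy // (ltn_eqF kj); exact.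
  rewrite -{2}yk; apply: run_inc; rewrite yk -ltnS.
  by apply: leq_trans ki _; case: bx => [[]].
have [|||z [rz Ez oz zm]] := loop (minn (reg x i) (reg x j)) 0 (set_reg m 0 x).
- by [].
- by rewrite /= eqxx.
- by rewrite env_set.
exists z; split=> //; last by rewrite Ez env_set.
exact: run_seq (run_reset w m x) rz.
Qed.

Lemma test_le c m i j : 1 < m -> i < m -> j < m ->
  test c m (le_prog i j m) (fun e => nth 0 e i <= nth 0 e j).
Proof.
move=> m1 im jm x [bx _]; have [y [ry Ey oy ym]] := run_count_to_min m1 im jm bx.
exists y; split=> //; apply: run_seq ry _; rewrite !nth_env //.
have := RxEq w m i y; rewrite ym; move/envP: Ey => ->//.
by rewrite (sameP minn_idPl eqP).
Qed.

Lemma test_succ c m i j : 1 < m -> i < m -> j < m ->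
  test c m (succ_prog i j m) (fun e => nth 0 e j == (nth 0 e i).+1).
Proof.
move=> m1 im jm x [bx _]; have [y [ry Ey oy ym]] := run_count_to_min m1 im jm bx.
have /envP E := Ey; rewrite !nth_env //.
have := RxEq w m j y; rewrite ym E //; move: ym.
case: (leqP (reg x j) (reg x i)) => le ym t.
  exists y; split=> //; apply: run_seq ry _; rewrite eqxx in t.
  apply: RxIf t _.
  have -> : (reg x j == (reg x i).+1) = false by rewrite ltn_eqF.
  exact: run_done.
exists (set_reg m (reg x i).+1 y); split=> //; last by rewrite env_set.
rewrite ltn_eqF // in t.
apply: run_seq ry _; apply: RxIf t _.
apply: (run_seq (y := set_reg m (reg x i).+1 y) (b := true)).
  rewrite -ym; apply: run_inc; rewrite ym -ltnS.
  by apply: leq_trans le _; case: bx => [[]].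
have := RxEq w m j (set_reg m (reg x i).+1 y).
by rewrite /= eqxx (ltn_eqF jm) E // eq_sym.
Qed.

Lemma emits_nil c m b : emits c m (rdone b) (fun=> [::]).
Proof. by move=> x _; exists b, x; rewrite cats0; split=> //; apply: run_done. Qed.

Lemma emits_out c m b : emits c m (Out b) (fun=> [:: b]).
Proof.
move=> x _; exists true, (RState (reg x) (ipos x) (rcons (out x) b)).
by case: x => v p o; split; [apply: RxOut | | rewrite cats1].
Qed.

Lemma emits_seq c m p q U V : 1 < m -> emits c m p U -> emits c m q V ->
  emits c m (rseq p q) (fun e => U e ++ V e).
Proof.
move=> m1 Hp Hq x rx; have [b [y [ry Ey oy]]] := Hp x rx.
have [b' [z [rz Ez oz]]] := Hq y (ready_run m1 ry Ey rx).
exists b', z; split; first exact: run_seq ry rz.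
  by rewrite Ez.
by rewrite oz oy Ey catA.
Qed.

Lemma emits_if c m p q r P U V : 1 < m -> test c m p P -> emits c m q U ->
  emits c m r V -> emits c m (RIf p q r) (fun e => if P e then U e else V e).
Proof.
move=> m1 Hp Hq Hr x rx; have [y [ry Ey oy]] := Hp x rx.
have ry' := ready_run m1 ry Ey rx.
case: (P _) ry => ry;
  [have [b [z [rz Ez oz]]] := Hq y ry' | have [b [z [rz Ez oz]]] := Hr y ry'];
  exists b, z; rewrite -Ey -oy; split=> //; exact: RxIf ry _.
Qed.

Definition emit_loop r p body m : rprog :=
  for_loop m r (RIf p body (rdone false)).

Lemma emits_loop c m r p body (D : nat -> bool) U : 1 < m -> r < m ->
  (forall x, based x -> reg x r = c) ->
  test c m.+1 p (fun e => D (nth 0 e m)) -> emits c m.+1 body U ->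
  emits c m (emit_loop r p body m)
    (fun e => flatten [seq U (rcons e i) | i <- iota 0 c & D i]).
Proof.
move=> m1 rm rc Hp Hb x [bsx xc]; have [bx x0 x1] := bsx.
have Hif := emits_if (ltnW m1 : 1 < m.+1) Hp Hb (@emits_nil c m.+1 false).
have mr : m != r by rewrite gtn_eqF.
have xr := rc x bsx.
have [|j y jc [P1 P2] by' yi yr|y [ry [P1 P2] yi yr]] :=
  @for_rule w m r (RIf p body (rdone false)) (fun j y => env m y = env m x /\
    out y = out x ++ flatten [seq U (rcons (env m x) i) | i <- iota 0 j & D i])
    _ x mr bx xr.
- by rewrite env_set cats0.
- have /envP P1' := P1.
  have rdy : ready c m.+1 y.
    split; first by split; rewrite ?P1' // ltnW.
    move=> l /andP[l1]; rewrite ltnS leq_eqVlt => /orP[/eqP->|lm].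
      by rewrite yi.
    by rewrite P1' // xc // l1.
  have [b [z [rz Ez oz]]] := Hif y rdy.
  have /envP Ez' := Ez.
  exists b, z; split=> //; first by rewrite Ez'.
    by rewrite Ez' // ltnW.
  rewrite env_set (env_weaken Ez) P1; split=> //.
  rewrite -[out (set_reg _ _ _)]/(out z).
  have -> : iota 0 j.+1 = iota 0 j ++ [:: j] by rewrite -addn1 iotaD.
  rewrite oz P2 -catA filter_cat map_cat flatten_cat; congr (_ ++ (_ ++ _)).
  rewrite envS yi P1 nth_rcons size_mkseq ltnn eqxx.
  by rewrite /=; case: (D j); rewrite /= ?cats0.
by exists false, y; split.
Qed.

Fixpoint nest_loop r (p : nat -> rprog) body k m : rprog :=
  if k is k'.+1 then emit_loop r (p m) (nest_loop r p body k' m.+1) m else body.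

(** The nested loops run through the tuples in the lexicographic order in which
    an encoding lists them. *)
Lemma emits_nest c m r p body k (D : nat -> bool) U : 1 < m -> r < 2 ->
  (forall x, based x -> reg x r = c) ->
  (forall l, 1 < l -> test c l.+1 (p l) (fun e => D (nth 0 e l))) ->
  emits c (m + k) body U ->
  emits c m (nest_loop r p body k m)
    (fun e => flatten [seq U (e ++ u) | u <- lex_seqs [seq i <- iota 0 c | D i] k]).
Proof.
move=> m1 r2 rc Hp; elim: k m m1 => [|k IH] m m1 Hb.
  rewrite addn0 in Hb; move=> x /Hb[b [y [ry Ey oy]]]; exists b, y.
  by rewrite /= !cats0.
rewrite addnS -addSn in Hb; have := IH m.+1 (ltnW m1) Hb.
move=> {IH}Hb' x rx.
have [b [y [ry Ey oy]]] := emits_loop m1 (leq_trans r2 m1) rc (Hp m m1) Hb' rx.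
exists b, y; split=> //; rewrite oy /=; congr (_ ++ _).
move: (lex_seqs _ k) => L.
elim: [seq i <- iota 0 c | D i] => //= i s IHs.
rewrite IHs map_cat flatten_cat -map_comp; congr (flatten _ ++ _).
by apply: eq_map => u /=; rewrite cat_rcons.
Qed.

End Tests.


(** * Evaluating formulas and writing structures *)

Lemma eq_sat_free (sigma : signature) (A : structure sigma)
    (phi : formula sigma) (v v' : nat -> dom A) :
  {in free_vars phi, v =1 v'} -> sat v phi = sat v' phi.
Proof.
elim: phi v v' => //=.
- by move=> i j v v' E; rewrite !E // !inE eqxx ?orbT.
- move=> R xs v v' E; suff -> : map_tuple v xs = map_tuple v' xs by [].
  by apply: val_inj; apply/eq_in_map.
- by move=> p IH v v' E; congr (~~ _); apply: IH.
- move=> p IHp q IHq v v' E; congr (_ && _); [apply: IHp | apply: IHq];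
    by move=> i iF; apply: E; rewrite mem_cat iF ?orbT.
- move=> p IHp q IHq v v' E; congr (_ || _); [apply: IHp | apply: IHq];
    by move=> i iF; apply: E; rewrite mem_cat iF ?orbT.
- move=> p IHp q IHq v v' E; congr (_ ==> _); [apply: IHp | apply: IHq];
    by move=> i iF; apply: E; rewrite mem_cat iF ?orbT.
- move=> x p IH v v' E; apply: eq_forallb => a; apply: IH => i iF /=.
  by case: eqP => // /eqP ix; apply: E; rewrite mem_filter ix.
- move=> x p IH v v' E; apply: eq_existsb => a; apply: IH => i iF /=.
  by case: eqP => // /eqP ix; apply: E; rewrite mem_filter ix.
Qed.

Lemma eq_sat (sigma : signature) (A : structure sigma)
    (phi : formula sigma) (v v' : nat -> dom A) :
  v =1 v' -> sat v phi = sat v' phi.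
Proof. by move=> E; apply: eq_sat_free => i _; apply: E. Qed.

Lemma sat_FRel (sigma : signature) (A : structure sigma) (v : nat -> dom A) R xs :
  sat v (FRel R xs) = holds R (map v xs).
Proof. by rewrite [LHS]/= -holds_tuple. Qed.

Fixpoint var_bound (sigma : signature) (phi : formula sigma) : nat :=
  match phi with
  | FFalse => 0
  | FEq i j => (maxn i j).+1
  | FRel _ xs => (\max_(i <- xs) i).+1
  | FNot p => var_bound p
  | FAnd p q | FOr p q | FImp p q => maxn (var_bound p) (var_bound q)
  | FAll i p | FEx i p => maxn i.+1 (var_bound p)
  end.

(** Register [m] saves the old value of [r], because a quantifier may rebind a
    variable whose outer value is needed later. *)
Definition search (r : nat) (p : rprog) (m : nat) : rprog :=
  rseq (copy m r) (rseq (Reset r)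
    (rseq (RWhile (rand (rnot (EqR r 0)) (rnot p)) (Inc r))
      (RIf (EqR r 0) (rseq (copy r m) (rdone false))
                     (rseq (copy r m) (rdone true))))).

(** Variable [i] lives in register [i + 2]. *)
Fixpoint eval_prog (sigma : signature) (phi : formula sigma) (m : nat) :
    rprog :=
  match phi with
  | FFalse => rdone false
  | FEq i j => EqR i.+2 j.+2
  | FRel R xs => lookup R [seq i.+2 | i <- xs] m
  | FNot p => rnot (eval_prog p m)
  | FAnd p q => rand (eval_prog p m) (eval_prog q m)
  | FOr p q => RIf (eval_prog p m) (rdone true) (eval_prog q m)
  | FImp p q => RIf (eval_prog p m) (eval_prog q m) (rdone true)
  | FAll i p => rnot (search i.+2 (rnot (eval_prog p m.+1)) m)
  | FEx i p => search i.+2 (eval_prog p m.+1) m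
  end.

Section Search.
Variables (w : seq bool) (n : nat).
Local Notation run := (rexec w).
Local Notation based := (based w n).

Lemma run_search r p m x (P : pred nat) : 1 < r < m -> based x ->
  (forall y, based y -> reg y r < n -> reg y m = reg x r ->
     (forall j, j < m -> j != r -> reg y j = reg x j) ->
     exists z, [/\ run p y (P (reg y r)) z, env m.+1 z = env m.+1 y &
                out z = out y]) ->
  exists y, [/\ run (search r p m) x (has P (iota 0 n)) y,
    env m y = env m x & out y = out x].
Proof.
move=> /andP[r1 rm] bsx Hp; have [bx x0 x1] := bsx.
have rm' : r == m = false by rewrite ltn_eqF.
have mr : m != r by rewrite gtn_eqF.
have r0 : 0 == r = false by rewrite ltn_eqF // ltnW.
have r1' : 1 == r = false by rewrite ltn_eqF.
have m1 : 1 < m by apply: ltn_trans rm.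
have [x2 [rx2 xm Ex2 px2 ox2]] := run_copy mr bx.
have {}Ex2 j : j < m -> reg x2 j = reg x j by move=> jm; rewrite Ex2 // ltn_eqF.
pose state y := [/\ based y, reg y m = reg x r, out y = out x &
  forall j, j < m -> j != r -> reg y j = reg x j].
have loop d k y : k + d = n -> reg y r = k -> state y ->
  exists b z, [/\ run (RWhile (rand (rnot (EqR r 0)) (rnot p)) (Inc r)) y b z,
    state z & (reg z r != n) = has P (iota k d)].
  elim: d k y => [|d IH] k y kd yk [bsy ym oy Ey];
    have [by' y0 y1] := bsy;
    have t := RxIf (run_not (RxEq w r 0 y)) _; rewrite yk y0 in t.
    rewrite addn0 in kd; rewrite kd eqxx in t yk.
    exists false, y; rewrite yk eqxx; split=> //.
    by apply: RxStop; apply: t; apply: run_done.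
  have kn : k < n by rewrite -kd addnS ltnS leq_addr.
  rewrite (ltn_eqF kn) in t.
  have [|z [rz Ez oz]] := Hp y bsy _ ym Ey; first by rewrite yk.
  have bsz : based z by apply: based_run rz Ez bsy; apply: ltnW.
  move: Ez => /envP Ez.
  have zk : reg z r = k by rewrite Ez ?yk // ltnW.
  have zm : reg z m = reg x r by rewrite Ez ?ym.
  have sz j : j < m -> j != r -> reg z j = reg x j.
    by move=> jm jr; rewrite Ez ?Ey // ltnW.
  have {t} t := t _ _ _ _ (run_not rz); rewrite yk in t rz.
  rewrite /=; case Pk: (P k) rz t => rz t /=.
    exists false, z; rewrite zk (ltn_eqF kn); split=> //; first exact: RxStop (t _).
    by split=> //; rewrite oz.
  have nw : n <= (size w).+1 by rewrite -x0; case: bx.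
  have zkw : reg z r <= size w by rewrite zk -ltnS (leq_trans kn).
  have [|||b [z' [rz' sz' Ez']]] := IH k.+1 (set_reg r k.+1 z).
  - by rewrite addSnnS.
  - by rewrite /= eqxx.
  - case: bsz => bz z0 z1; split=> //=.
    + split; rewrite /= ?r0 ?r1' //.
      by apply: bounded_set => //; apply: leq_trans kn nw.
    + by rewrite (negPf mr).
    + by rewrite oz.
    + by move=> j jm jr; rewrite (negPf jr) sz.
  exists b, z'; split=> //; apply: RxLoop (t _) _ rz'.
  by rewrite -zk; apply: run_inc.
have [|||b [z [rz [bsz zm oz Ez] zP]]] := loop n 0 (set_reg r 0 x2).
- by [].
- by rewrite /= eqxx.
- split=> /=.
  + split; rewrite /= ?r0 ?r1' ?Ex2 // ?(ltnW m1) //.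
    by apply: bounded_set => //; apply: rexec_bounded rx2 bx.
  + by rewrite (negPf mr).
  + by [].
  + by move=> j jm jr; rewrite (negPf jr) Ex2.
have [bz z0 z1] := bsz.
have rm2 : r != m by rewrite eq_sym.
have [y [ry yr Ey py oy]] := run_copy rm2 bz.
exists y; split; last by rewrite oy.
  apply: run_seq rx2 _; apply: run_seq (run_reset w r x2) _.
  apply: run_seq rz _; apply: RxIf (RxEq w r 0 z) _.
  rewrite z0 -zP; case: (reg z r == n); apply: run_seq ry _; exact: run_done.
by apply/envP => j jm; case: (eqVneq j r) => [->|jr]; rewrite ?yr // Ey // Ez.
Qed.

End Search.

Section Evaluation.
Variables (sigma : signature) (A : structure sigma).
Local Notation w := (encode A).
Local Notation n := #|dom A|.

Lemma exists_elem (P : pred (dom A)) :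
  has (fun i => P (elem A i)) (iota 0 n) = [exists a, P a].
Proof.
rewrite -(has_map (elem A)) -enum_elem.
by apply/hasP/existsP => [[a _ Pa]|[a Pa]]; exists a; rewrite ?mem_enum.
Qed.

Definition assigned K x (v : nat -> dom A) : Prop :=
  forall i, i < K -> reg x i.+2 < n /\ v i = elem A (reg x i.+2).

Lemma assigned_run K m x p b y (v : nat -> dom A) : K.+2 <= m ->
  based w n x -> rexec w p x b y -> env m y = env m x -> assigned K x v ->
  based w n y /\ assigned K y v.
Proof.
move=> Km bx ry Ey xv.
split; first by apply: based_run ry Ey bx; apply: leq_trans Km.
move=> i iK; move/envP: Ey => ->; first exact: xv.
by apply: leq_trans Km; rewrite !ltnS.
Qed.

(** The bound [K] on the variables stays fixed while [m] grows with the depth of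
    quantifiers, because each quantifier saves one register at [m]. *)
Lemma run_eval K (phi : formula sigma) m x (v : nat -> dom A) :
  var_bound phi <= K -> K.+2 <= m -> based w n x ->
  assigned K x v ->
  exists y, [/\ rexec w (eval_prog phi m) x (sat v phi) y,
    env m y = env m x & out y = out x].
Proof.
elim: phi m x v => [|i j|R xs|p IH|p IHp q IHq|p IHp q IHq|p IHp q IHq|i p IH|i p IH]
  m x v phiK Km bx xv; have m1 : 1 < m by [apply: leq_trans Km].
- by exists x; split=> //; apply: run_done.
- rewrite /= gtn_max in phiK; have /andP[iK jK] := phiK.
  exists x; split=> //=; have := RxEq w i.+2 j.+2 x.
  have [il ->] := xv i iK; have [jl ->] := xv j jK.
  suff -> : (elem A (reg x i.+2) == elem A (reg x j.+2)) = (reg x i.+2 == reg x j.+2) by [].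
  by apply/eqP/eqP => [/(congr1 (@code _ A))|->//]; rewrite !elemK.
- have xsK i : i \in (xs : seq nat) -> i < K.
    by move=> ixs; apply: leq_trans phiK; rewrite /= ltnS; apply: (@leq_bigmax_seq _ _ predT id).
  have rsm : all (gtn m) [seq i.+2 | i <- xs].
    rewrite all_map; apply/allP => i /xsK iK /=.
    by apply: leq_trans Km; rewrite !ltnS.
  have := @test_lookup w n (size w).+2 m sigma R _ m1 rsm x.
  case; first by split=> // j _; case: bx => [[bv _] _ _]; rewrite ltnS.
  move=> y [ry Ey oy]; exists y; split=> //; rewrite sat_FRel.
  set u := (X in bit_index _ _ X) in ry.
  have Eu : map (elem A) u = map v xs.
    rewrite /u -!map_comp; apply/eq_in_map => i ixs /=.
    have [_ ->] := xv i (xsK i ixs); rewrite nth_env //.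
    by apply: leq_trans Km; rewrite !ltnS; apply: xsK.
  rewrite encode_bit ?Eu // in ry.
    by rewrite /u !size_map size_tuple.
  rewrite /u -map_comp all_map; apply/allP => i ixs /=.
  have [lt _] := xv i (xsK i ixs); rewrite nth_env //.
  by apply: leq_trans Km; rewrite !ltnS; apply: xsK.
- have [y [ry Ey oy]] := IH m x v phiK Km bx xv.
  by exists y; split=> //; apply: run_not.
- rewrite /= geq_max in phiK; have /andP[pK qK] := phiK.
  have [y [ry Ey oy]] := IHp m x v pK Km bx xv.
  have [by' yv] := assigned_run Km bx ry Ey xv.
  have [z [rz Ez oz]] := IHq m y v qK Km by' yv.
  rewrite /=; case: (sat v p) ry => ry.
    by exists z; rewrite Ez oz; split=> //; apply: RxIf ry rz.
  by exists y; split=> //; apply: RxIf ry (run_done _ _ _).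
- rewrite /= geq_max in phiK; have /andP[pK qK] := phiK.
  have [y [ry Ey oy]] := IHp m x v pK Km bx xv.
  have [by' yv] := assigned_run Km bx ry Ey xv.
  have [z [rz Ez oz]] := IHq m y v qK Km by' yv.
  rewrite /=; case: (sat v p) ry => ry.
    by exists y; split=> //; apply: RxIf ry (run_done _ _ _).
  by exists z; rewrite Ez oz; split=> //; apply: RxIf ry rz.
- rewrite /= geq_max in phiK; have /andP[pK qK] := phiK.
  have [y [ry Ey oy]] := IHp m x v pK Km bx xv.
  have [by' yv] := assigned_run Km bx ry Ey xv.
  have [z [rz Ez oz]] := IHq m y v qK Km by' yv.
  rewrite /=; case: (sat v p) ry => ry.
    by exists z; rewrite Ez oz; split=> //; apply: RxIf ry rz.
  by exists y; split=> //; apply: RxIf ry (run_done _ _ _).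
- rewrite /= geq_max in phiK; have /andP[iK pK] := phiK.
  have im : 1 < i.+2 < m by apply: leq_trans Km; rewrite !ltnS.
  have E : [forall a, sat [eta v with i |-> a] p] =
      ~~ has (fun a => ~~ sat [eta v with i |-> elem A a] p) (iota 0 n).
    by rewrite (exists_elem (fun a => ~~ sat [eta v with i |-> a] p))
               -negb_forall negbK.
  rewrite /= E.
  have [|y [ry Ey oy]] := @run_search w n i.+2 (rnot (eval_prog p m.+1)) m x
     (fun a => ~~ sat [eta v with i |-> elem A a] p) im bx; last first.
    by exists y; split=> //; apply: run_not.
  move=> y by' yi ym Ey.
  have [||z [rz Ez oz]] := IH m.+1 y [eta v with i |-> elem A (reg y i.+2)] pK _ by' _.
  + exact: leqW.
  + move=> j jK /=; case: eqP => [->//|/eqP ji]; rewrite Ey //; first exact: xv.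
    by apply: leq_trans Km; rewrite !ltnS.
  by exists z; split=> //; apply: run_not.
- rewrite /= geq_max in phiK; have /andP[iK pK] := phiK.
  have im : 1 < i.+2 < m by apply: leq_trans Km; rewrite !ltnS.
  rewrite /= -(exists_elem (fun a => sat [eta v with i |-> a] p)).
  apply: (@run_search w n i.+2 _ m x
     (fun a => sat [eta v with i |-> elem A a] p) im bx).
  move=> y by' yi ym Ey.
  apply: IH => //; first exact: leqW.
  move=> j jK /=; case: eqP => [->//|/eqP ji]; rewrite Ey //; first exact: xv.
  by apply: leq_trans Km; rewrite !ltnS.
Qed.

Lemma test_eval (phi : formula sigma) m : var_bound phi <= m ->
  test w n n m.+2 (eval_prog phi m.+2)
    (fun e => sat (fun i => elem A (nth 0 e i.+2)) phi).
Proof.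
move=> phim x [bx xc]; apply: (run_eval phim) => // i im; split.
  by apply: xc; rewrite !ltnS im.
by rewrite nth_env.
Qed.

End Evaluation.

Definition not_right (x : input_symbol) : bool :=
  if x is RightEnd then false else true.

(** The encoding starts with the size of the domain in unary, and its length is
    found by walking to the right end. *)
Definition init_prog : rprog :=
  rseq InR (rseq (RWhile (Read is_one) (rseq (Inc 0) InR))
    (rseq rewind_input (rseq InR (RWhile (Read not_right) (rseq (Inc 1) InR))))).

Lemma run_count w i (f : input_symbol -> bool) d x :
  (forall j, j < d -> f (input_at w (ipos x + j))) ->
  ~~ f (input_at w (ipos x + d)) -> ipos x + d <= (size w).+1 ->
  reg x i + d <= (size w).+1 ->
  exists y, [/\ rexec w (RWhile (Read f) (rseq (Inc i) InR)) x false y,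
   reg y i = reg x i + d, forall j, j != i -> reg y j = reg x j & out y = out x].
Proof.
elim: d x => [|d IH] x.
  move=> _; rewrite !addn0 => /negPf fx _ _; exists x; split=> //.
  by apply: RxStop; have := RxRead w f x; rewrite fx.
move=> fj fd pd rd.
have t := RxRead w f x; move: t; rewrite -{1}[ipos x]addn0 fj // => t.
have rw : reg x i <= size w.
  by rewrite -ltnS; apply: leq_trans rd; rewrite addnS ltnS leq_addr.
have pw : ipos x <= size w.
  by rewrite -ltnS; apply: leq_trans pd; rewrite addnS ltnS leq_addr.
set x1 := set_reg i (reg x i).+1 x.
have r2 := run_right w x1; set x2 := RState _ _ _ in r2.
have x2p : ipos x2 = (ipos x).+1 by rewrite /= minnSS (minn_idPl pw).
have x2i : reg x2 i = (reg x i).+1 by rewrite /= eqxx.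
have [||||y [ry yi yj oy]] := IH x2; rewrite ?x2p ?x2i.
- by move=> j jd; rewrite addSnnS; apply: fj.
- by rewrite addSnnS.
- by rewrite addSnnS.
- by rewrite addSnnS.
exists y; split=> //; last first.
- by move=> j ji; rewrite yj //= (negPf ji).
- by rewrite yi x2i addSnnS.
apply: RxLoop t _ ry; exact: run_seq (run_inc rw) r2.
Qed.

Lemma run_init w n rest : w = nseq n true ++ false :: rest ->
  exists x, [/\ rexec w init_prog start_state false x, based w n x,
    forall j, 1 < j -> reg x j = 0 & out x = [::]].
Proof.
move=> Ew; have sw : size w = n + (size rest).+1.
  by rewrite Ew size_cat size_nseq.
have nw : n < size w by rewrite sw addnS ltnS leq_addr.
have r1 := run_right w start_state.
set x1 := RState _ _ _ in r1.
have p1 : ipos x1 = 1 by rewrite /= minnSS min0n.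
have [||||x2 [r2 x20 x2j o2]] := @run_count w 0 is_one n x1; rewrite ?p1.
- move=> j jn; rewrite add1n /= (ltn_trans jn nw).
  by rewrite Ew nth_cat size_nseq jn nth_nseq jn.
- by rewrite add1n /= nw Ew nth_cat size_nseq ltnn subnn.
- by rewrite add1n ltnS ltnW.
- exact: leqW (ltnW nw).
have r3 := run_rewind w x2.
set x3 := RState _ _ _ in r3.
have r4 := run_right w x3.
set x4 := RState _ _ _ in r4.
have p4 : ipos x4 = 1 by rewrite /= minnSS min0n.
have x41 : reg x4 1 = 0 by rewrite /= x2j.
have [||||x5 [r5 x51 x5j o5]] := @run_count w 1 not_right (size w) x4; rewrite ?p4 ?x41.
- by move=> j jw; rewrite add1n /= jw.
- by rewrite add1n /= ltnn.
- by rewrite add1n.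
- exact: leqnSn.
have run : rexec w init_prog start_state false x5.
  apply: run_seq r1 _; apply: run_seq r2 _; apply: run_seq r3 _.
  exact: run_seq r4 r5.
have x50 : reg x5 0 = n by rewrite x5j //= x20.
exists x5; split=> //.
- split=> //; last by rewrite x51 x41.
  exact: rexec_bounded run _.
- by move=> j j1; rewrite x5j ?gtn_eqF //= x2j // gtn_eqF // ltnW.
- by rewrite o5 /= o2.
Qed.

Definition print_prog (u : seq bool) : rprog :=
  foldr (fun b => rseq (Out b)) (rdone true) u.

Lemma emits_print w n c m u : 1 < m -> emits w n c m (print_prog u) (fun=> u).
Proof.
move=> m1; elim: u => [|b u IH] /=; first exact: emits_nil.
exact: (emits_seq m1 (@emits_out w n c m b) IH).
Qed.

Definition test_bit (p : rprog) : rprog := RIf p (Out true) (Out false).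

Lemma emits_test w n c m p P : 1 < m -> test w n c m p P ->
  emits w n c m (test_bit p) (fun e => [:: P e]).
Proof.
move=> m1 Hp x rx.
have [b [y [ry Ey oy]]] := emits_if m1 Hp (@emits_out w n c m true) (@emits_out w n c m false) rx.
by exists b, y; split=> //; rewrite oy; case: (P _).
Qed.

Definition structure_prog (sigma : signature) (r : nat) (p : nat -> rprog)
    (body : sym sigma -> rprog) : rprog :=
  rseq (emit_loop r (p 2) (Out true) 2) (rseq (Out false)
    (foldr (fun R => rseq (nest_loop r p (test_bit (body R)) (arity R) 2))
       (rdone true) (enum (sym sigma)))).

Lemma emits_structure w n c (sigma : signature) r (p : nat -> rprog)
    (body : sym sigma -> rprog) (D : nat -> bool)
    (F : sym sigma -> seq nat -> bool) :
  r < 2 -> (forall x, based w n x -> reg x r = c) ->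
  (forall l, 1 < l -> test w n c l.+1 (p l) (fun e => D (nth 0 e l))) ->
  (forall R, test w n c (arity R).+2 (body R) (fun e => F R (drop 2 e))) ->
  let L := [seq i <- iota 0 c | D i] in
  emits w n c 2 (structure_prog r p body)
    (fun=> nseq (size L) true ++ false :: tables L F).
Proof.
move=> r2 rc Hp HF L.
have dom_out := emits_loop (isT : 1 < 2) r2 rc (Hp 2 isT) (@emits_out w n c 3 true).
have tabs s : emits w n c 2
    (foldr (fun R => rseq (nest_loop r p (test_bit (body R)) (arity R) 2))
       (rdone true) s)
    (fun=> flatten [seq [seq F R u | u <- lex_seqs L (arity R)] | R <- s]).
  elim: s => [|R s IH] /=; first exact: emits_nil.
  apply: emits_seq => // x rx.
  have [b [y [ry Ey oy]]] :=
    emits_nest (isT : 1 < 2) r2 rc Hp (@emits_test w n c (arity R).+2 _ _ isT (HF R)) rx.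
  exists b, y; split=> //; rewrite oy; congr (_ ++ _).
  elim: (lex_seqs _ _) => //= u us ->.
  by rewrite drop0.
move=> x rx.
have [b [y [ry Ey oy]]] := emits_seq (isT : 1 < 2) dom_out
  (emits_seq (isT : 1 < 2) (@emits_out w n c 2 false) (tabs (enum (sym sigma)))) rx.
exists b, y; split=> //; rewrite oy; congr (_ ++ (_ ++ _)).
by rewrite -/L; elim: (L) => //= i s ->.
Qed.


(** * Splitting off the extension conjuncts *)

Lemma sat_foralls (sigma : signature) (A : structure sigma) xs p
    (v : nat -> dom A) :
  sat v (foralls xs p) <->
  forall v' : nat -> dom A, (forall i, i \notin xs -> v' i = v i) -> sat v' p.
Proof.
elim: xs v => [|x xs IH] v /=.
  split=> [s v' E|]; last by apply.
  by rewrite (eq_sat _ (v' := v)) // => i; apply: E.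
split=> [/forallP s v' E|H].
  have /IH := s (v' x); apply => i ixs /=.
  by case: eqP => [->//|/eqP ix]; apply: E; rewrite inE negb_or ix.
apply/forallP => a; apply/IH => v' E; apply: H => i.
by rewrite inE negb_or => /andP[ix ixs]; rewrite E //= (negPf ix).
Qed.

Lemma free_foralls (sigma : signature) xs (p : formula sigma) :
  free_vars (foralls xs p) = [seq y <- free_vars p | y \notin xs].
Proof.
elim: xs => [|x xs IH] /=; first by rewrite filter_predT.
rewrite IH -filter_predI; apply: eq_filter => y /=.
by rewrite inE negb_or.
Qed.

Definition emptied (sigma : signature) (P : pred (sym sigma))
    (M : structure sigma) : structure sigma :=
  @Structure sigma (dom M) (dom_gt0 M)
    (fun R => if P R then set0 else interp M R).

Lemma holds_emptied (sigma : signature) (P : pred (sym sigma))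
    (M : structure sigma) R (u : seq (dom M)) :
  @holds _ (emptied P M) R u = ~~ P R && @holds _ M R u.
Proof.
rewrite /holds /=; case: insubP => [t _ _|_]; last by rewrite andbF.
by case: (P R); rewrite ?inE.
Qed.

Lemma sat_emptied_eq (sigma : signature) (P P' : pred (sym sigma))
    (M : structure sigma) p (v : nat -> dom M) :
  (forall R, 0 < occurrences R p -> P R = P' R) ->
  @sat _ (emptied P M) v p = @sat _ (emptied P' M) v p.
Proof.
elim: p v => //=.
- by move=> R xs v E; rewrite E // eqxx.
- by move=> p IH v E; rewrite IH.
- by move=> p IHp q IHq v E; rewrite IHp ?IHq // => R occ; apply: E;
    rewrite addn_gt0 occ ?orbT.
- by move=> p IHp q IHq v E; rewrite IHp ?IHq // => R occ; apply: E;
    rewrite addn_gt0 occ ?orbT.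
- by move=> p IHp q IHq v E; rewrite IHp ?IHq // => R occ; apply: E;
    rewrite addn_gt0 occ ?orbT.
- by move=> i p IH v E; apply: eq_forallb => a; apply: IH.
- by move=> i p IH v E; apply: eq_existsb => a; apply: IH.
Qed.

Lemma occurrences_conjunct (sigma : signature) R (chi phi : formula sigma) :
  conjunct chi phi -> occurrences R chi <= occurrences R phi.
Proof.
elim: phi => [|i j|Q xs|p IH|p IHp q IHq|p IHp q IHq|p IHp q IHq|i p IH|i p IH] /=;
  try by case=> // <-.
case=> [<-//|[/IHp le|/IHq le]]; apply: leq_trans le _.
  exact: leq_addr.
exact: leq_addl.
Qed.

(** All occurrences of [R] are used up by [chi], which is joined to the rest of
    [phi] by conjunctions only, so emptying [R] cannot affect the rest. *)
Lemma sat_conjunct (sigma : signature) (P P' : pred (sym sigma))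
    (M : structure sigma) (R : sym sigma) (chi phi : formula sigma) :
  (forall Q, Q != R -> P Q = P' Q) ->
  conjunct chi phi -> occurrences R phi = 1 -> 0 < occurrences R chi ->
  (forall v, @sat _ (emptied P' M) v chi) -> forall v : nat -> dom M,
  @sat _ (emptied P M) v phi =
    @sat _ (emptied P' M) v phi && @sat _ (emptied P M) v chi.
Proof.
move=> PP' cj o1 o2 s v.
elim: phi cj o1 => [|i j|Q xs|p IH|p IHp q IHq|p IHp q IHq|p IHp q IHq|i p IH|i p IH];
  try by case=> // E _; rewrite E s.
case=> [E _|cpq]; first by rewrite E s.
rewrite /=; case: cpq => [cp|cq] o1.
- have op := occurrences_conjunct R cp.
  have q0 : occurrences R q = 0.
    apply/eqP; rewrite -leqn0 -(leq_add2l 1) addn0 -{2}o1 leq_add2r.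
    exact: leq_trans o2 op.
  rewrite IHp //; last by rewrite q0 addn0 in o1.
  rewrite (@sat_emptied_eq _ P P' M q) 1?andbAC // => Q oQ; apply: PP'.
  by apply: contraL oQ => /eqP->; rewrite q0.
have oq := occurrences_conjunct R cq.
have p0 : occurrences R p = 0.
  apply/eqP; rewrite -leqn0 -(leq_add2r 1) add0n -{2}o1 leq_add2l.
  exact: leq_trans o2 oq.
rewrite IHq //; last by rewrite p0 add0n in o1.
rewrite (@sat_emptied_eq _ P P' M p) ?andbA // => Q oQ; apply: PP'.
by apply: contraL oQ => /eqP->; rewrite p0.
Qed.

Lemma sat_emptied_none (sigma : signature) (P : pred (sym sigma))
    (M : structure sigma) p (v : nat -> dom M) :
  (forall R, P R = false) -> @sat _ (emptied P M) v p = sat v p.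
Proof.
move=> P0; elim: p v => //=.
- by move=> R xs v; rewrite P0.
- by move=> p IH v; rewrite IH.
- by move=> p IHp q IHq v; rewrite IHp IHq.
- by move=> p IHp q IHq v; rewrite IHp IHq.
- by move=> p IHp q IHq v; rewrite IHp IHq.
- by move=> i p IH v; apply: eq_forallb => a; apply: IH.
- by move=> i p IH v; apply: eq_existsb => a; apply: IH.
Qed.

Lemma map_index (T : Type) (x0 : T) (xs : seq nat) (u : seq T) :
  uniq xs -> size u = size xs -> [seq nth x0 u (index i xs) | i <- xs] = u.
Proof.
move=> uxs su; apply: (@eq_from_nth _ x0); rewrite size_map // => j jx.
by rewrite (nth_map 0) // index_uniq.
Qed.

Lemma sat_inclusion (sigma : signature) (M : structure sigma)
    (R1 R2 : sym sigma) (e : arity R1 = arity R2) (xs : (arity R1).-tuple nat)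
    (v : nat -> dom M) : uniq xs ->
  (sat v (foralls xs (FImp (FRel R1 xs) (FRel R2 (tcast e xs)))) <->
   forall u : seq (dom M), holds R1 u -> holds R2 u).
Proof.
move=> uxs; rewrite sat_foralls.
have impE v' : sat v' (FImp (FRel R1 xs) (FRel R2 (tcast e xs))) =
    holds R1 (map v' xs) ==> holds R2 (map v' xs).
  rewrite -[LHS]/(sat v' (FRel R1 xs) ==> sat v' (FRel R2 (tcast e xs))).
  by rewrite !sat_FRel val_tcast.
split=> [H u u1|H v' _]; last by rewrite impE; apply/implyP; apply: H.
pose v' i := if i \in (xs : seq nat) then nth (v 0) u (index i xs) else v i.
have v'xs : map v' xs = u.
  rewrite -[RHS](@map_index _ (v 0) xs u) ?(holds_size u1) ?size_tuple //.
  by apply/eq_in_map => i ixs; rewrite /v' ixs.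
have /H : forall i, i \notin (xs : seq nat) -> v' i = v i.
  by move=> i /negPf ixs; rewrite /v' ixs.
by rewrite impE v'xs u1.
Qed.

Lemma occurrences_foralls (sigma : signature) R xs (p : formula sigma) :
  occurrences R (foralls xs p) = occurrences R p.
Proof. by elim: xs. Qed.

Definition extended_by (tau : signature) (Psi : eso tau)
    (prime : sym (eso_sig Psi) -> sym tau) : Prop :=
  forall R : sym (eso_sig Psi),
    let R1 : sym (sig_union tau (eso_sig Psi)) := inl (prime R) in
    let R2 : sym (sig_union tau (eso_sig Psi)) := inr R in
    occurrences R1 (eso_body Psi) = 1 /\
    exists (e : arity R1 = arity R2) (xs : (arity R1).-tuple nat),
      uniq xs /\
      conjunct (foralls xs (FImp (FRel R1 xs) (FRel R2 (tcast e xs))))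
        (eso_body Psi).

Section Extensional.
Variables (tau : signature) (Psi : eso tau).
Local Notation rho := (eso_sig Psi).
Variable prime : sym rho -> sym tau.
Hypothesis prime_inj : injective prime.
Hypothesis ext : extended_by prime.

Definition primed_in (l : seq (sym rho)) : pred (sym (sig_union tau rho)) :=
  fun R => if R is inl Q then Q \in map prime l else false.

Section Expansion.
Variables (A : structure tau).
Variable I : forall R : sym rho, {set (arity R).-tuple (dom A)}.
Local Notation M := (expansion I).

(** The extension conjuncts are inclusions; what remains of the sentence does not
    mention the extension symbols, which may thus be taken to be empty. Removing
    the conjuncts one by one needs that [prime] is injective: emptying one
    extension symbol must not touch the conjunct of another. *)
Lemma sat_split_extension (l : seq (sym rho)) (v : nat -> dom A) : uniq l ->
  @sat _ M v (eso_body Psi) <->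
  @sat _ (emptied (primed_in l) M) v (eso_body Psi) /\
  forall R, R \in l -> forall u : seq (dom A),
    holds (prime R) u -> @holds _ M (inr R) u.
Proof.
elim: l => [_|R l IH /= /andP[Rl ul]].
  rewrite (@sat_emptied_none _ _ M); first by split=> [|[]].
  by case.
have [o1 [e [xs [uxs cj]]]] := ext R.
set R1 : sym (sig_union tau rho) := inl (prime R) in o1 e xs uxs cj *.
set R2 : sym (sig_union tau rho) := inr R in e cj *.
set chi := foralls _ _ in cj.
have step := @sat_conjunct _ (primed_in l) (primed_in (R :: l)) M R1 chi
  (eso_body Psi) _ cj o1 _ _ v.
rewrite IH // step; first last.
- by move=> v'; apply/(sat_inclusion (M := emptied _ M) e v' uxs) => u;
    rewrite holds_emptied /= inE eqxx.
- by rewrite /chi occurrences_foralls /= eqxx.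
- by case=> // Q; rewrite /primed_in /= inE => QR; rewrite (negbTE (QR : Q != prime R)).
have pR : prime R \notin map prime l by rewrite mem_map.
have chiE : @sat _ (emptied (primed_in l) M) v chi <->
    forall u : seq (dom A), holds (prime R) u -> @holds _ M (inr R) u.
  rewrite (sat_inclusion (M := emptied _ M) e v uxs).
  split=> H u; have := H u; rewrite !holds_emptied /= pR //=.
split=> [[/andP[s1 /chiE c1] c2]|[s1 c]].
  by split=> // Q; rewrite inE => /orP[/eqP->|/c2].
split; last by move=> Q Ql; apply: c; rewrite inE Ql orbT.
by rewrite s1; apply/chiE; apply: c; rewrite inE eqxx.
Qed.

End Expansion.
End Extensional.


(** * The hereditary sentence *)

Lemma holds_induced (sigma : signature) (B : structure sigma)
    (S : {set dom B}) (hS : S != set0) R (u : seq (dom (induced hS))) :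
  holds R u = holds R [seq val x | x <- u].
Proof.
rewrite /holds; case: insubP => [t /= st ut|st].
  have -> : [seq val x | x <- u] = map_tuple val t by rewrite -ut.
  by rewrite valK inE.
by rewrite insubN // size_map.
Qed.

Definition conj_all (sigma : signature) (l : seq (formula sigma)) :
    formula sigma := foldr (@FAnd sigma) (FNot FFalse) l.

Lemma sat_conj_all (sigma : signature) (A : structure sigma) l
    (v : nat -> dom A) : sat v (conj_all l) = all (sat v) l.
Proof. by elim: l => //= p l ->. Qed.

Section Connectives.
Variables (sigma : signature) (A : structure sigma) (v : nat -> dom A).
Implicit Types p q : formula sigma.

Lemma sat_FFalse : sat v (@FFalse sigma) = false. Proof. by []. Qed.
Lemma sat_FEq i j : sat v (FEq i j) = (v i == v j). Proof. by []. Qed.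
Lemma sat_FNot p : sat v (FNot p) = ~~ sat v p. Proof. by []. Qed.
Lemma sat_FAnd p q : sat v (FAnd p q) = sat v p && sat v q. Proof. by []. Qed.
Lemma sat_FOr p q : sat v (FOr p q) = sat v p || sat v q. Proof. by []. Qed.
Lemma sat_FImp p q : sat v (FImp p q) = (sat v p ==> sat v q).
Proof. by []. Qed.
Lemma sat_FAll i p : sat v (FAll i p) = [forall a, sat [eta v with i |-> a] p].
Proof. by []. Qed.
Lemma sat_FEx i p : sat v (FEx i p) = [exists a, sat [eta v with i |-> a] p].
Proof. by []. Qed.

End Connectives.

Definition satE :=
  (sat_FFalse, sat_FEq, sat_FNot, sat_FAnd, sat_FOr, sat_FImp,
   sat_FAll, sat_FEx).

Lemma map_nth_block (T : Type) (x0 : T) (s1 s2 s3 : seq T) k n :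
  k = size s1 -> n = size s2 ->
  [seq nth x0 (s1 ++ s2 ++ s3) i | i <- iota k n] = s2.
Proof.
move=> -> ->; rewrite map_nth_iota; last first.
  by rewrite !size_cat addKn leq_addr.
by rewrite drop_size_cat // take_size_cat.
Qed.

Section Hereditary.
Variables (tau rho : signature).

(** The symbols of tau; for each quantified relation a symbol that ties an element
    to a tuple; a binary order and a binary successor. Elements [x] with [x <= x]
    form the ordered part, which plays the role of the domain. Other elements
    may be tied to tuples: the presence of such an element in a substructure means
    that the tuple is outside of the quantified relation. *)
Definition her_sig : signature :=
  @Signature ((sym tau + sym rho) + bool)%type
    (fun R => match R with
              | inl (inl Q) => arity Q
              | inl (inr Q) => (arity Q).+1
              | inr _ => 2
              end).

Definition keep (Q : sym tau) : sym her_sig := inl (inl Q).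
Definition del (R : sym rho) : sym her_sig := inl (inr R).
Definition ord : sym her_sig := inr true.
Definition nxt : sym her_sig := inr false.

Definition f_le (i j : nat) : formula her_sig := FRel ord [tuple of [:: i; j]].
Definition f_next (i j : nat) : formula her_sig :=
  FRel nxt [tuple of [:: i; j]].
Definition f_del (R : sym rho) (t : nat) (xs : (arity R).-tuple nat) :
    formula her_sig := FRel (del R) [tuple of t :: xs].

(** The variables 0, 1 and 2 are free, to be read as universally quantified. The
    last formula says that [next 0 1] leaves no element between 0 and 1, where
    the successor of the last element is the first one. *)
Definition linear_order : seq (formula her_sig) :=
  [:: FImp (FAnd (f_le 0 1) (f_le 1 0)) (FEq 0 1);
      FImp (FAnd (f_le 0 1) (f_le 1 2)) (f_le 0 2);
      FImp (FAnd (f_le 0 0) (f_le 1 1)) (FOr (f_le 0 1) (f_le 1 0));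
      FImp (FAnd (f_next 0 1) (f_le 2 2))
        (FAnd (FOr (f_le 2 0) (f_le 1 2))
              (FImp (f_le 1 0) (FAnd (f_le 1 2) (f_le 2 0))))].

Definition del_fresh (R : sym rho) : formula her_sig :=
  FImp (f_del 0 [tuple of iota 1 (arity R)]) (FNot (f_le 0 0)).

Definition del_functional (R Q : sym rho) : formula her_sig :=
  FImp (FAnd (f_del 0 [tuple of iota 1 (arity R)])
             (f_del 0 [tuple of iota (arity R).+1 (arity Q)]))
    (if R == Q then
       conj_all [seq FEq i (arity R + i) | i <- iota 1 (arity R)]
     else FFalse).

(** Without quantifiers, hence inherited by substructures; a structure that
    violates it is itself a substructure that does. *)
Definition alpha : formula her_sig :=
  conj_all (linear_order ++ [seq del_fresh R | R <- enum (sym rho)] ++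
    [seq del_functional R Q | R <- enum (sym rho), Q <- enum (sym rho)]).

(** Not inherited by substructures: this is what forces a substructure to keep
    the whole ordered part. *)
Definition chain : formula her_sig :=
  FAnd (FEx 0 (f_le 0 0))
    (FAll 0 (FImp (f_le 0 0) (FEx 1 (FAnd (f_le 1 1) (f_next 0 1))))).

Section Meaning.
Variable B : structure her_sig.
Implicit Types (x y z : dom B) (u : seq (dom B)).

Definition le x y : bool := holds ord [:: x; y].
Definition next_to x y : bool := holds nxt [:: x; y].
Definition deletes R x u : bool := holds (del R) (x :: u).

Lemma sat_le (v : nat -> dom B) i j : sat v (f_le i j) = le (v i) (v j).
Proof. exact: sat_FRel. Qed.

Lemma sat_next (v : nat -> dom B) i j : sat v (f_next i j) = next_to (v i) (v j).
Proof. exact: sat_FRel. Qed.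

Lemma sat_del (v : nat -> dom B) R t (xs : (arity R).-tuple nat) :
  sat v (f_del t xs) = deletes R (v t) [seq v i | i <- xs].
Proof. exact: sat_FRel. Qed.

Record wellformed : Prop := Wellformed {
  wf_anti : forall x y, le x y -> le y x -> x = y;
  wf_trans : forall x y z, le x y -> le y z -> le x z;
  wf_total : forall x y, le x x -> le y y -> le x y || le y x;
  wf_next : forall x y z, next_to x y -> le z z ->
    (le z x || le y z) && (le y x ==> (le y z && le z x));
  wf_fresh : forall R x u, deletes R x u -> ~~ le x x;
  wf_functional : forall R Q x u u', deletes R x u -> deletes Q x u' ->
    R = Q /\ u = u' }.

Lemma deletes_size R x u : deletes R x u -> size u = arity R.
Proof. by move=> /holds_size /= [->]. Qed.

Definition atomE := (sat_le, sat_next, sat_del).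

Lemma sat_linear_order (v : nat -> dom B) : all (sat v) linear_order =
  [&& le (v 0) (v 1) && le (v 1) (v 0) ==> (v 0 == v 1),
      le (v 0) (v 1) && le (v 1) (v 2) ==> le (v 0) (v 2),
      le (v 0) (v 0) && le (v 1) (v 1) ==> le (v 0) (v 1) || le (v 1) (v 0) &
      next_to (v 0) (v 1) && le (v 2) (v 2) ==>
        (le (v 2) (v 0) || le (v 1) (v 2)) &&
        (le (v 1) (v 0) ==> (le (v 1) (v 2) && le (v 2) (v 0)))].
Proof.
have allE (p : formula her_sig) l : all (sat v) (p :: l) = sat v p && all (sat v) l by [].
by rewrite /linear_order !allE !satE !atomE andbT.
Qed.

Lemma sat_alpha (v : nat -> dom B) : sat v alpha = all (sat v) linear_order &&
    (all (fun R => sat v (del_fresh R)) (enum (sym rho)) &&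
     all (fun R => all (fun Q => sat v (del_functional R Q)) (enum (sym rho)))
       (enum (sym rho))).
Proof.
rewrite /alpha sat_conj_all !all_cat all_map; congr (_ && (_ && _)).
have gen s s' : all (sat v) [seq del_functional R Q | R <- s, Q <- s'] =
    all (fun R => all (fun Q => sat v (del_functional R Q)) s') s.
  by elim: s => //= R s IH; rewrite all_cat IH all_map.
exact: gen.
Qed.

Lemma alphaP : (forall v : nat -> dom B, sat v alpha) <-> wellformed.
Proof.
split=> [H|[anti trans total next fresh fn] v].
  have lin x y z : all (sat (nth x [:: x; y; z])) linear_order.
    by have := H (nth x [:: x; y; z]); rewrite sat_alpha => /andP[].
  have Hfresh (v : nat -> dom B) R : sat v (del_fresh R).
    by have := H v; rewrite sat_alpha => /and3P[_ /allP h _]; apply: h; rewrite mem_enum.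
  have Hfn (v : nat -> dom B) R Q : sat v (del_functional R Q).
    have := H v; rewrite sat_alpha => /and3P[_ _ /allP h].
    have /allP := h R (mem_enum _ R); apply; exact: mem_enum.
  split.
  - move=> x y xy yx; have := lin x y y; rewrite sat_linear_order /=.
    by rewrite xy yx => /andP[/eqP].
  - move=> x y z xy yz; have := lin x y z; rewrite sat_linear_order /=.
    by rewrite xy yz => /and3P[_].
  - move=> x y xx yy; have := lin x y y; rewrite sat_linear_order /=.
    by rewrite xx yy => /and4P[_ _].
  - move=> x y z nx zz; have := lin x y z; rewrite sat_linear_order /=.
    by rewrite nx zz => /and4P[_ _ _].
  - move=> R x u d; have := Hfresh (nth x (x :: u)) R.
    rewrite /del_fresh !satE !atomE /= -[x :: u]cats0 -[x :: u]cat1s -catA.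
    rewrite map_nth_block ?(deletes_size d) //=.
    by move/implyP; apply.
  - move=> R Q x u u' dR dQ; have := Hfn (nth x (x :: u ++ u')) R Q.
    rewrite /del_functional !satE !atomE.
    have -> : [seq nth x (x :: u ++ u') i | i <- iota 1 (arity R)] = u.
      by rewrite -cat1s map_nth_block // (deletes_size dR).
    have -> : [seq nth x (x :: u ++ u') i | i <- iota (arity R).+1 (arity Q)] = u'.
      have := @map_nth_block _ x (x :: u) u' [::] (arity R).+1 (arity Q).
      by rewrite cats0 /= (deletes_size dR) (deletes_size dQ); apply.
    rewrite dR dQ /=; case: eqP => [E|//] s; split=> //.
    have su := deletes_size dR; have su' := deletes_size dQ.
    apply: (@eq_from_nth _ x); first by rewrite su su' E.
    move=> i; rewrite su => iR.
    move: s; rewrite sat_conj_all all_map => /allP/(_ i.+1).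
    rewrite mem_iota /= add1n ltnS iR => /(_ isT) /=; rewrite addnS /= !nth_cat.
    by rewrite su iR ltnNge leq_addr /= addKn => /eqP.
rewrite sat_alpha sat_linear_order; apply/andP; split.
  apply/and4P; split=> //; apply/implyP => /andP[h1 h2].
  - by apply/eqP; apply: anti.
  - exact: trans h1 h2.
  - exact: total.
  - exact: next.
apply/andP; split.
  apply/allP => R _; rewrite /del_fresh !satE !atomE.
  by apply/implyP; apply: fresh.
apply/allP => R _; apply/allP => Q _.
rewrite /del_functional !satE !atomE.
apply/implyP => /andP[dR dQ]; have [E Eu] := fn _ _ _ _ _ dR dQ.
rewrite -E eqxx sat_conj_all all_map; apply/allP => i.
rewrite mem_iota add1n => /andP[i0 iR] /=.
have := congr1 (fun s => nth (v 0) s i.-1) Eu.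
have iR' : i.-1 < arity R by rewrite prednK.
rewrite !(nth_map 0) ?size_iota -?E ?nth_iota // => Ev; apply/eqP; move: Ev.
by rewrite add1n addSn -addnS !prednK.
Qed.

Definition linked : Prop :=
  (exists x, le x x) /\
  forall x, le x x -> exists2 y, le y y & next_to x y.

Lemma chainP (v : nat -> dom B) : sat v chain <-> linked.
Proof.
rewrite /chain sat_FAnd sat_FEx sat_FAll.
split=> [/andP[/existsP[x sx] /forallP H]|[[x xx] H]].
  split=> [|y yy]; first by exists x; rewrite sat_le /= in sx.
  have := H y; rewrite sat_FImp sat_FEx sat_le => /implyP/(_ yy)/existsP[z].
  by rewrite sat_FAnd !atomE /= => /andP[zz yz]; exists z.
apply/andP; split; first by apply/existsP; exists x; rewrite sat_le.
apply/forallP => y; rewrite sat_FImp sat_FEx sat_le; apply/implyP => /H[z zz yz].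
by apply/existsP; exists z; rewrite sat_FAnd !atomE /= zz.
Qed.

End Meaning.

Lemma wellformed_sub (B C : structure her_sig) (f : dom C -> dom B) :
  injective f ->
  (forall R (u : seq (dom C)), holds R u = holds R (map f u)) ->
  wellformed B -> wellformed C.
Proof.
move=> fI fE [anti trans total next fresh fn].
have leE x y : le x y = le (f x) (f y) by apply: fE.
have nextE x y : next_to x y = next_to (f x) (f y) by apply: fE.
have delE R x u : deletes R x u = deletes R (f x) (map f u) by apply: fE.
split.
- by move=> x y; rewrite !leE => xy yx; apply: fI; apply: anti.
- by move=> x y z; rewrite !leE; apply: trans.
- by move=> x y; rewrite !leE; apply: total.
- by move=> x y z; rewrite !leE nextE; apply: next.
- by move=> R x u; rewrite leE delE; apply: fresh.
- move=> R Q x u u'; rewrite !delE => /fn h /h[-> E]; split=> //.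
  exact: (inj_map fI).
Qed.

Section Forcing.
Variables (B : structure her_sig) (S : {set dom B}) (hS : S != set0).
Hypothesis wfB : wellformed B.

Lemma wellformed_induced : wellformed (induced hS).
Proof.
apply: (@wellformed_sub B (induced hS) (fun x : {x | x \in S} => val x)) wfB.
  exact: val_inj.
by move=> R u; apply: holds_induced.
Qed.

Lemma le_induced (x y : dom (induced hS)) : le x y = le (val x) (val y).
Proof. exact: holds_induced. Qed.

Lemma next_induced (x y : dom (induced hS)) :
  next_to x y = next_to (val x) (val y).
Proof. exact: holds_induced. Qed.

(** A linked substructure loses no element of the order: the last element
    before a missing one would have no successor. *)
Lemma linked_full : linked (induced hS) -> forall z, le z z -> z \in S.
Proof.
case: wfB => anti trans total next _ _ [[x0 xx0] link] z zz.
apply: contraT => zS.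
have xz (x : dom (induced hS)) : val x != z.
  by apply: contraNneq zS => <-; apply: (valP x).
have linkS (x : dom (induced hS)) : le x x -> exists2 y : dom (induced hS), le y y &
    next_to (val x) (val y).
  by move=> /link[y yy]; rewrite next_induced; exists y.
pose rank (x : dom (induced hS)) := #|[set t | le t (val x)]|.
have rank_lt (x y : dom (induced hS)) :
    le x x -> le y y -> ~~ le (val y) (val x) -> rank x < rank y.
  rewrite !le_induced => xx yy yx; apply: proper_card; apply/properP; split.
    have xy : le (val x) (val y) by have := total _ _ xx yy; rewrite (negPf yx) orbF.
    by apply/subsetP => t; rewrite !inE => tx; apply: trans tx xy.
  by exists (val y); rewrite !inE.
pose low (x : dom (induced hS)) := le x x && le (val x) z.
(* From an element below [z], successors would climb towards [z] forever. *)
have nolow x : ~~ low x.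
  have [k] := ubnP (#|dom B| - rank x); elim: k x => // k IH x /ltnSE le_k.
  apply/negP => /andP[xx xlez]; have [y yy nx] := linkS x xx.
  have zx : ~~ le z (val x).
    by apply: contra (xz x) => zlex; apply/eqP; apply: anti.
  have /andP[] := next _ _ _ nx zz; rewrite (negPf zx) andbF implybF /= => ylez nyx.
  have lt := rank_lt x y xx yy nyx.
  suff /IH : #|dom B| - rank y < k by rewrite /low yy ylez.
  apply: leq_trans le_k; apply: ltn_sub2l => //.
  by apply: leq_trans lt _; apply: max_card.
have all_above (x : dom (induced hS)) : le x x -> ~~ le (val x) z.
  by move=> xx; have := nolow x; rewrite /low xx.
(* So all elements are above [z], but the successor of the last one is not. *)
have [x xx xmax] := @arg_maxnP _ x0 (fun x => le x x) rank xx0.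
have [y yy nx] := linkS x xx.
have /andP[+ /implyP h] := next _ _ _ nx zz; rewrite (negPf (all_above y yy)) orbF => zx.
case yx : (le (val y) (val x)); first by have := h yx; rewrite (negPf (all_above y yy)).
have := rank_lt x y xx yy; rewrite yx => /(_ isT).
by move=> lt; have := xmax y yy; rewrite /= leqNgt lt.
Qed.

Lemma linked_restrict : linked (induced hS) -> linked B.
Proof.
move=> lk; have full := linked_full lk; case: lk => -[x0 xx0] link.
split; first by exists (val x0); rewrite -le_induced.
move=> x xx; have xS := full x xx.
have [] := link (exist _ x xS); first by rewrite le_induced.
by move=> y; rewrite le_induced next_induced => yy nx; exists (val y).
Qed.

Lemma linked_extend : linked B -> (forall z, le z z -> z \in S) ->
  linked (induced hS).
Proof.
move=> [[x0 xx0] link] full; split.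
  by exists (exist _ x0 (full _ xx0)); rewrite le_induced.
move=> x; rewrite le_induced => /link[y yy nx].
by exists (exist _ y (full y yy)); rewrite ?le_induced ?next_induced.
Qed.

End Forcing.

End Hereditary.


(** * Correctness of the hereditary sentence *)

Section Translation.
Variables (tau : signature) (Psi : eso tau).
Local Notation rho := (eso_sig Psi).
Variable prime : sym rho -> sym tau.
Hypothesis prime_inj : injective prime.
Hypothesis ext : extended_by prime.
Local Notation sg := (sig_union tau rho).
Local Notation hs := (her_sig tau rho).

Lemma arity_prime R : arity (prime R) = arity R.
Proof. by case: (ext R) => _ [e _]. Qed.

Definition fresh_var (xs : seq nat) : nat := (\max_(i <- xs) i).+1.

Lemma fresh_varP xs : fresh_var xs \notin xs.
Proof.
apply/negP => H; have := @leq_bigmax_seq _ xs predT id _ H isT.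
by rewrite ltnn.
Qed.

(** An extension symbol becomes false, and [R xs] says that no element present is
    tied to the tuple [xs]. *)
Definition tr_atom (R : sym sg) : (@arity sg R).-tuple nat -> formula hs :=
  match R return (@arity sg R).-tuple nat -> formula hs with
  | inl Q => fun xs =>
      if Q \in codom prime then FFalse else @FRel hs (keep rho Q) xs
  | inr Q => fun xs =>
      FNot (FEx (fresh_var xs) (@f_del tau rho Q (fresh_var xs) xs))
  end.

Fixpoint tr (p : formula sg) : formula hs :=
  match p with
  | FFalse => FFalse
  | FEq i j => FEq i j
  | FRel R xs => tr_atom xs
  | FNot p => FNot (tr p)
  | FAnd p q => FAnd (tr p) (tr q)
  | FOr p q => FOr (tr p) (tr q)
  | FImp p q => FImp (tr p) (tr q)
  | FAll i p => FAll i (FImp (f_le tau rho i i) (tr p))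
  | FEx i p => FEx i (FAnd (f_le tau rho i i) (tr p))
  end.

Lemma free_tr p : {subset free_vars (tr p) <= free_vars p}.
Proof.
elim: p => //=.
- by move=> i j x.
- case=> Q xs x /=; first by case: ifP.
  by rewrite eqxx /= mem_filter => /andP[].
- by move=> p IHp q IHq x; rewrite !mem_cat => /orP[/IHp->//|/IHq->]; rewrite orbT.
- by move=> p IHp q IHq x; rewrite !mem_cat => /orP[/IHp->//|/IHq->]; rewrite orbT.
- by move=> p IHp q IHq x; rewrite !mem_cat => /orP[/IHp->//|/IHq->]; rewrite orbT.
- by move=> i p IH x; rewrite eqxx /= !mem_filter /= => /andP[-> /IH].
- by move=> i p IH x; rewrite eqxx /= !mem_filter /= => /andP[-> /IH].
Qed.

Definition primed_sym : pred (sym sg) := primed_in prime (enum (sym rho)).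

Section Semantics.
Variables (A : structure tau) (C : structure hs).
Variable I : forall R : sym rho, {set (arity R).-tuple (dom A)}.
Variable e : dom A -> dom C.
Hypothesis e_inj : injective e.
Hypothesis e_le : forall a, le (e a) (e a).
Hypothesis e_onto : forall c, le c c -> exists a, c = e a.
Hypothesis keepE : forall Q (u : seq (dom A)), Q \notin codom prime ->
  holds Q u = @holds _ C (keep rho Q) (map e u).
Hypothesis delE : forall R (u : seq (dom A)), size u = arity R ->
  @holds _ (expansion I) (inr R) u = ~~ [exists t : dom C, deletes R t (map e u)].

Lemma sat_tr p (v : nat -> dom A) :
  @sat _ (emptied primed_sym (expansion I)) v p = sat (fun i => e (v i)) (tr p).
Proof.
elim: p v => //=.
- by move=> i j v; rewrite (inj_eq e_inj).
- case=> Q xs v.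
    rewrite -[LHS]/(@sat _ (emptied primed_sym (expansion I)) v (@FRel sg (inl Q) xs)).
    rewrite sat_FRel holds_emptied /=.
    rewrite (_ : Q \in map prime _ = (Q \in codom prime)); last by [].
    case: ifP => [_ //|/negbT Qp].
    by rewrite andTb sat_FRel [LHS]keepE // -map_comp.
  rewrite -[LHS]/(@sat _ (emptied primed_sym (expansion I)) v (@FRel sg (inr Q) xs)).
  rewrite sat_FRel holds_emptied /= delE ?size_map ?size_tuple //.
  congr (~~ _); apply: eq_existsb => t.
  rewrite -[RHS]/(sat _ (@f_del tau rho Q (fresh_var xs) xs)) sat_del /= eqxx -map_comp; congr deletes.
  apply/eq_in_map => i ixs /=; case: eqP => // E.
  by have := fresh_varP xs; rewrite -E ixs.
- by move=> p IH v; rewrite IH.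
- by move=> p IHp q IHq v; rewrite IHp IHq.
- by move=> p IHp q IHq v; rewrite IHp IHq.
- by move=> p IHp q IHq v; rewrite IHp IHq.
- move=> i p IH v.
  have E a : sat (fun j => e ([eta v with i |-> a] j)) (tr p) =
             sat [eta (fun j => e (v j)) with i |-> e a] (tr p).
    by apply: eq_sat => j /=; case: eqP.
  apply/forallP/forallP => /= H c.
    rewrite -[X in X ==> _]/(sat _ (f_le tau rho i i)).
    rewrite sat_le /= eqxx; apply/implyP => /e_onto[a ->].
    by rewrite -E -IH.
  have := H (e c); rewrite -[X in X ==> _]/(sat _ (f_le tau rho i i)) sat_le /= eqxx e_le /=.
  by rewrite -E -IH.
- move=> i p IH v.
  have E a : sat (fun j => e ([eta v with i |-> a] j)) (tr p) =
             sat [eta (fun j => e (v j)) with i |-> e a] (tr p).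
    by apply: eq_sat => j /=; case: eqP.
  apply/existsP/existsP => /= -[c].
    rewrite IH E => s; exists (e c).
    by rewrite -[X in X && _]/(sat _ (f_le tau rho i i)) sat_le /= eqxx e_le.
  rewrite -[X in X && _]/(sat _ (f_le tau rho i i)) sat_le /= eqxx.
  by move=> /andP[/e_onto[a ->]]; rewrite -E -IH => s; exists a.
Qed.

End Semantics.

Definition her_matrix : formula hs :=
  FAnd (alpha tau rho) (FNot (FAnd (chain tau rho) (tr (eso_body Psi)))).

(** Closing under universal quantifiers is harmless: [models] quantifies over all
    assignments anyway. *)
Definition her_sentence : formula hs := foralls (free_vars her_matrix) her_matrix.

Lemma her_sentence_closed : sentence her_sentence.
Proof.
rewrite /sentence free_foralls /nilp size_filter -leqn0 leqNgt -has_count.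
by apply/hasP => -[x xF]; rewrite xF.
Qed.

Lemma models_her (B : structure hs) :
  models B her_sentence <-> wellformed B /\
    forall v : nat -> dom B, ~~ (sat v (chain tau rho) && sat v (tr (eso_body Psi))).
Proof.
rewrite -alphaP; split=> [H|[wf ns] v].
  have s (v : nat -> dom B) : sat v her_matrix.
    by have /sat_foralls/(_ v) := H v; apply.
  by split=> v; have /andP[] := s v.
apply/sat_foralls => v' _; apply/andP; split; [exact: wf | exact: ns].
Qed.

Lemma sat_body_tr_indep (C : structure hs) (v v' : nat -> dom C) :
  sat v (tr (eso_body Psi)) = sat v' (tr (eso_body Psi)).
Proof.
apply: eq_sat_free => x /free_tr.
by have := eso_closed Psi; rewrite /sentence => /nilP->.
Qed.

Lemma eso_modelsE (A : structure tau) : eso_models A Psi <->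
  exists I : forall R : sym rho, {set (arity R).-tuple (dom A)},
    (forall v : nat -> dom A,
      @sat _ (emptied primed_sym (expansion I)) v (eso_body Psi)) /\
    forall R (u : seq (dom A)), holds (prime R) u -> @holds _ (expansion I) (inr R) u.
Proof.
have split_all I (v : nat -> dom A) :=
  @sat_split_extension tau Psi prime prime_inj ext A I _ v (enum_uniq (sym rho)).
split=> -[I].
  move=> H; exists I; split=> [v|R].
    by have /split_all[] := H v.
  have /split_all[_] := H (fun=> elem0 A).
  by apply; rewrite mem_enum.
move=> [s H]; exists I => v; apply/split_all; split; first exact: s.
by move=> R _; apply: H.
Qed.

(** A structure is one of its own substructures. *)
Lemma her_wellformed (B : structure hs) : Her her_sentence B -> wellformed B.
Proof.
move=> H; have h : [set: dom B] != set0.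
  by apply/set0Pn; exists (elem0 B); rewrite inE.
have /models_her[wf _] := H _ h.
pose f (x : dom B) : dom (induced h) := exist _ x (in_setT x).
apply: (wellformed_sub (f := f)) wf; first by move=> x y [].
by move=> R u; rewrite holds_induced -map_comp map_id_in.
Qed.

(** By [linked_full] a linked substructure would contain the whole ordered part,
    and its successors would link it. *)
Lemma her_unlinked (B : structure hs) :
  wellformed B -> ~ linked B -> Her her_sentence B.
Proof.
move=> wf nl S hS; apply/models_her; split; first exact: wellformed_induced.
move=> v; apply/negP => /andP[/chainP lk _]; apply: nl.
exact: linked_restrict wf lk.
Qed.

Section Link.
Variables (A : structure tau) (B : structure hs) (e : dom A -> dom B).
Hypothesis e_inj : injective e.
Hypothesis e_le : forall a, le (e a) (e a).
Hypothesis e_onto : forall c, le c c -> exists a, c = e a.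
Hypothesis keepE : forall Q (u : seq (dom A)), Q \notin codom prime ->
  holds Q u = @holds _ B (keep rho Q) (map e u).
Hypothesis primeE : forall R (u : seq (dom A)), size u = arity R ->
  holds (prime R) u = ~~ [exists t : dom B, deletes R t (map e u)].
Hypothesis wf : wellformed B.
Hypothesis lk : linked B.

(** If [I] solves Psi, keep the elements tied to tuples outside of [I]; the ordered
    part is kept because it is not tied to anything. Conversely, a substructure
    that satisfies [chain] contains the image of [A], and determines a solution:
    the tuples to which none of its elements is tied. Tuples to which no element
    of [B] is tied are the ones that the extension symbols force into a solution. *)
Theorem her_link : Her her_sentence B <-> ~ eso_models A Psi.
Proof.
split=> [H /eso_modelsE[I [sI primeI]]|nmod S hS].
  (* An element is kept unless it is tied to a tuple of the solution. *)
  pose S := [set t : dom B | [forall R, forall u : (arity R).-tuple (dom A),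
    deletes R t (map e u) ==> (u \notin I R)]].
  have full z : le z z -> z \in S.
    move=> zz; rewrite inE; apply/forallP => R; apply/forallP => u.
    by apply/implyP => /(wf_fresh wf); rewrite zz.
  have hS : S != set0 by apply/set0Pn; exists (e (elem0 A)); apply: full.
  have /models_her[_ ns] := H S hS.
  pose e' a : dom (induced hS) := exist _ (e a) (full _ (e_le a)).
  have := ns (fun=> e' (elem0 A)); apply/negP; rewrite negbK; apply/andP; split.
    by apply/chainP; apply: linked_extend.
  rewrite -(@sat_tr A (induced hS) I e' _ _ _ _ _ (eso_body Psi) (fun=> elem0 A)) //.
  - by move=> a b [] /e_inj.
  - by move=> a; rewrite le_induced; apply: e_le.
  - move=> c; rewrite le_induced => /e_onto[a ca]; exists a.
    by apply: val_inj.
  - by move=> Q u Qp; rewrite holds_induced -map_comp keepE.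
  move=> R u su; have [t ut] : exists t : (arity R).-tuple (dom A), u = t.
    by have /eqP su' := su; exists (Tuple su').
  rewrite ut holds_tuple; apply/idP/existsPn => [tI [x xS]|nx].
    apply/negP; rewrite /deletes holds_induced /= -map_comp => d.
    move: xS; rewrite inE => /forallP/(_ R)/forallP/(_ t)/implyP.
    by move=> /(_ d); rewrite tI.
  apply: contraT => tI.
  have : ~~ holds (prime R) u.
    by apply/negP => /primeI; rewrite ut holds_tuple (negPf tI).
  rewrite primeE // negbK => /existsP[x d].
  have xS : x \in S.
    rewrite inE; apply/forallP => Q; apply/forallP => u'; apply/implyP => d'.
    have [EQ] := wf_functional wf d d'; rewrite ut => /(inj_map e_inj) E.
    move: u' d' E; rewrite -EQ => u' _ E; suff <- : t = u' by [].
    exact: val_inj.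
  have := nx (exist _ x xS); rewrite /deletes holds_induced /= -map_comp.
  by rewrite -[X in ~~ X]/(deletes R x (map e t)) -ut d.
apply/models_her; split; first exact: wellformed_induced.
move=> v; apply/negP => /andP[/chainP lkS strS]; apply: nmod.
have full := linked_full wf lkS.
pose e' a : dom (induced hS) := exist _ (e a) (full _ (e_le a)).
pose I R := [set u : (arity R).-tuple (dom A) |
  ~~ [exists t : dom (induced hS), deletes R t (map e' u)]].
apply/eso_modelsE; exists I.
have delI R (u : seq (dom A)) : size u = arity R ->
  @holds _ (expansion I) (inr R) u =
    ~~ [exists t : dom (induced hS), deletes R t (map e' u)].
  move=> su; have [t ->] : exists t : (arity R).-tuple (dom A), u = t.
    by have /eqP su' := su; exists (Tuple su').
  by rewrite holds_tuple inE.
split=> [w|R u pu].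
  rewrite (@sat_tr A (induced hS) I e') //.
  - by rewrite (sat_body_tr_indep _ v).
  - by move=> a b [] /e_inj.
  - by move=> a; rewrite le_induced; apply: e_le.
  - move=> c; rewrite le_induced => /e_onto[a ca]; exists a.
    by apply: val_inj.
  - by move=> Q u Qp; rewrite holds_induced -map_comp keepE.
have su : size u = arity R by rewrite (holds_size pu) arity_prime.
rewrite delI //; apply/existsPn => -[x xS]; move: pu; rewrite primeE //.
move=> /existsPn/(_ x); apply: contra.
by rewrite /deletes holds_induced /= -map_comp.
Qed.

End Link.
End Translation.


(** * From structures to hereditary structures *)

Section ReadyEnv.
Variables (w : seq bool) (n : nat).

Lemma ready_env c m x : ready w n c m.+2 x ->
  exists2 u, env m.+2 x = [:: n, size w & u] & size u = m /\ all (gtn c) u.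
Proof.
move=> [[_ x0 x1] xc]; exists [seq reg x i | i <- iota 2 m].
  by rewrite /env /mkseq /= x0 x1.
rewrite size_map size_iota; split=> //; rewrite all_map; apply/allP => i.
by rewrite mem_iota => /xc.
Qed.

Definition lt_all (rs : seq nat) (m : nat) : rprog :=
  foldr (fun r => rand (rnot (le_prog 0 r m))) (rdone true) rs.

Lemma test_lt_all c m rs : 1 < m -> all (gtn m) rs ->
  test w n c m (lt_all rs m) (fun e => all (fun r => nth 0 e r < nth 0 e 0) rs).
Proof.
move=> m1; elim: rs => [_|r rs IH /andP[rm /IH{}IH]] /=; first exact: test_done.
apply: eq_test (test_and m1 (test_not (test_le m1 (ltnW m1) rm)) IH).
by move=> x _; rewrite -ltnNge.
Qed.

Definition zero_prog j m : rprog := rseq (Reset m) (EqR m j).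

Lemma test_zero c m j : j < m -> test w n c m (zero_prog j m) (fun e => nth 0 e j == 0).
Proof.
move=> jm x _; exists (set_reg m 0 x); rewrite env_set; split=> //.
rewrite nth_env //; apply: run_seq (run_reset _ _ _) _.
have := RxEq w m j (set_reg m 0 x).
by rewrite /= eqxx (ltn_eqF jm) eq_sym.
Qed.

Lemma map_nth_drop (e : seq nat) k m : size e = k + m ->
  [seq nth 0 e r | r <- iota k m] = drop k e.
Proof.
move=> se; rewrite map_nth_iota; last by rewrite se addKn.
by rewrite take_oversize // size_drop se addKn.
Qed.

End ReadyEnv.

Section Reductions.
Variables (tau : signature) (Psi : eso tau).
Local Notation rho := (eso_sig Psi).
Variable prime : sym rho -> sym tau.
Hypothesis prime_inj : injective prime.
Hypothesis ext : extended_by prime.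
Local Notation hs := (her_sig tau rho).
Local Notation phi := (@her_sentence tau Psi prime).

Section Positions.
Variable A : structure tau.
Local Notation w := (encode A).
Local Notation n := #|dom A|.

(** The elements are the positions of the encoding [w] of [A]: those below [n]
    stand for the elements of [A], and a position with a zero bit in the table of
    an extension symbol is tied to the tuple of that bit. So the positions are
    never more than the input is long, and one register holds one of them. *)
Definition position_bits (R : sym hs) (u : seq nat) : bool :=
  match R with
  | inl (inl Q) => all (gtn n) u && nth false w (bit_index n Q u)
  | inl (inr R) =>
      let k := bit_index n (prime R) (behead u) in
      [&& all (gtn n) (behead u), k == nth 0 u 0 & ~~ nth false w k]
  | inr true => (nth 0 u 0 <= nth 0 u 1) && (nth 0 u 1 < n)
  | inr false => [&& nth 0 u 0 < n, nth 0 u 1 < n &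
      (nth 0 u 1 == (nth 0 u 0).+1) ||
      (nth 0 u 1 == 0) && (n == (nth 0 u 0).+1)]
  end.

Lemma size_encode_gt : n < size w.
Proof. by rewrite encode_tables size_cat size_nseq /= addnS ltnS leq_addr. Qed.

Lemma positions_gt0 : 0 < size (iota 0 (size w)).
Proof. by rewrite size_iota (leq_ltn_trans _ size_encode_gt). Qed.

Definition positions : structure hs := tabulated positions_gt0 position_bits.

Lemma size_positions : size (iota 0 (size w)) = size w.
Proof. exact: size_iota. Qed.

Lemma holds_positions R (u : seq (dom positions)) :
  holds R u = (size u == arity R) && position_bits R (map val u).
Proof.
rewrite holds_tabulated; congr (_ && position_bits R _).
apply: eq_map => i; rewrite nth_iota ?add0n //.
by rewrite -[X in _ < X]size_positions ltn_ord.
Qed.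

Lemma positions_le (x y : dom positions) : le x y = (val x <= val y) && (val y < n).
Proof. by rewrite /le holds_positions. Qed.

Lemma positions_next (x y : dom positions) : next_to x y =
  [&& val x < n, val y < n & (val y == (val x).+1) || (val y == 0) && (n == (val x).+1)].
Proof. by rewrite /next_to holds_positions. Qed.

Lemma positions_deletes R (x : dom positions) (u : seq (dom positions)) :
  deletes R x u = [&& size u == arity R, all (gtn n) (map val u),
    bit_index n (prime R) (map val u) == val x &
    ~~ nth false w (bit_index n (prime R) (map val u))].
Proof. by rewrite /deletes holds_positions /= eqSS. Qed.

Lemma positions_wellformed : wellformed positions.
Proof.
split.
- move=> x y; rewrite !positions_le => /andP[xy _] /andP[yx _].
  by apply: val_inj; apply/eqP; rewrite eqn_leq xy.
- move=> x y z; rewrite !positions_le => /andP[xy _] /andP[yz ->].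
  by rewrite (leq_trans xy yz).
- move=> x y; rewrite !positions_le !leqnn /= => xn yn.
  by rewrite xn yn !andbT leq_total.
- move=> x y z; rewrite !positions_le positions_next leqnn /= => /and3P[xn yn].
  rewrite xn !andbT => /orP[/eqP->|/andP[/eqP-> /eqP E]] zn.
    by rewrite zn ltnn !andbT leqNgt orNb.
  have -> : z <= x by rewrite -ltnS -E.
  by rewrite zn.
- move=> R x u; rewrite positions_deletes positions_le leqnn /=.
  move=> /and4P[_ _ /eqP<- _]; rewrite -leqNgt ltnW //; exact: bit_index_ge.
- move=> R Q x u u'; rewrite !positions_deletes.
  move=> /and4P[/eqP su un /eqP Ex _] /and4P[/eqP su' un' /eqP Ex' _].
  have [] := @bit_index_inj _ n (prime R) (prime Q) (map val u) (map val u') _ un _ un' _.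
  + by rewrite size_map su (arity_prime ext).
  + by rewrite size_map su' (arity_prime ext).
  + by rewrite Ex Ex'.
  by move=> /prime_inj-> /(inj_map val_inj).
Qed.

Lemma positions_linked : linked positions.
Proof.
have lt i : i < n -> i < size (iota 0 (size w)).
  by move=> lt; rewrite size_positions (ltn_trans lt size_encode_gt).
have n0 : 0 < n := dom_gt0 A.
split; first by exists (Ordinal (lt 0 n0)); rewrite positions_le.
move=> x; rewrite positions_le leqnn /= => xn.
case: (ltnP (val x).+1 n) => [x1n|nx].
  exists (Ordinal (lt _ x1n)); rewrite ?positions_le ?positions_next /= ?leqnn //.
  by rewrite xn x1n eqxx.
exists (Ordinal (lt 0 n0)); rewrite ?positions_le ?positions_next /= ?n0 //.
by rewrite xn eqn_leq nx xn.
Qed.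

Lemma position_lt (a : dom A) : code a < size (iota 0 (size w)).
Proof. by rewrite size_positions (ltn_trans (code_lt a) size_encode_gt). Qed.

Definition position (a : dom A) : dom positions := Ordinal (position_lt a).

Lemma map_position (u : seq (dom A)) : map val (map position u) = map (@code _ A) u.
Proof. by rewrite -map_comp. Qed.

Lemma all_code (u : seq (dom A)) : all (gtn n) (map (@code _ A) u).
Proof. by apply/allP => i /mapP[a _ ->] /=; apply: code_lt. Qed.

Lemma bit_code Q (u : seq (dom A)) : size u = arity Q ->
  nth false w (bit_index n Q (map (@code _ A) u)) = holds Q u.
Proof.
move=> su; rewrite encode_bit ?size_map ?all_code //.
by rewrite (mapK (@codeK _ A)).
Qed.

(** A tuple is outside of an extension symbol iff its bit is zero, that is, iff
    some position is tied to it. *)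
Theorem positions_correct : Her phi positions <-> ~ eso_models A Psi.
Proof.
apply: (her_link prime_inj ext (e := position)).
- by move=> a b /(congr1 val) /code_inj.
- by move=> a; rewrite positions_le leqnn /= code_lt.
- move=> c; rewrite positions_le leqnn /= => cn; exists (elem A (val c)).
  by apply: val_inj; rewrite /= elemK.
- move=> Q u _; rewrite holds_positions /= size_map map_position all_code /=.
  case: eqP => [su|su]; first by rewrite bit_code.
  by apply/negP => /holds_size.
- move=> R u su; have sp : size u = arity (prime R) by rewrite su (arity_prime ext).
  apply/idP/existsPn => [h t|h].
    by rewrite positions_deletes map_position bit_code // h !andbF.
  apply: contraT => nh.
  have lt : bit_index n (prime R) (map (@code _ A) u) < size (iota 0 (size w)).
    by rewrite size_positions bit_index_lt ?size_map ?all_code.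
  have := h (Ordinal lt); rewrite positions_deletes map_position bit_code // nh.
  by rewrite size_map su all_code !eqxx.
- exact: positions_wellformed.
- exact: positions_linked.
Qed.

End Positions.

Definition position_prog (R : sym hs) : rprog :=
  match R with
  | inl (inl Q) =>
      let rs := iota 2 (arity Q) in
      let m := (arity Q).+2 in rand (lt_all rs m) (lookup Q rs m)
  | inl (inr R) =>
      let rs := iota 3 (arity R) in
      let m := (arity R).+3 in
      rand (lt_all rs m) (rand (at_bit (prime R) rs 2 m)
                               (rnot (lookup (prime R) rs m)))
  | inr true => rand (le_prog 2 3 4) (rnot (le_prog 0 3 4))
  | inr false => rand (rnot (le_prog 0 2 4)) (rand (rnot (le_prog 0 3 4))
      (RIf (succ_prog 2 3 4) (rdone true)
         (rand (zero_prog 3 4) (succ_prog 2 0 4))))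
  end.

Lemma test_position_prog (A : structure tau) R :
  test (encode A) #|dom A| (size (encode A)) (arity R).+2 (position_prog R)
    (fun e => position_bits A R (drop 2 e)).
Proof.
set w := encode A; set n := #|dom A|.
case: R => [[Q|R]|[]].
- have rs : all (gtn (arity Q).+2) (iota 2 (arity Q)).
    by apply/allP => i; rewrite mem_iota => /andP[].
  rewrite /position_prog; apply: eq_test; last first.
    by apply: test_and => //; [apply: test_lt_all | apply: test_lookup].
  move=> x rx; have [u -> [su _]] := ready_env rx.
  have E : [seq nth 0 [:: n, size w & u] i | i <- iota 2 (arity Q)] = u.
    by rewrite map_nth_drop //= ?drop0 // su.
  rewrite -[X in X && _](all_map (nth 0 [:: n, size w & u]) (gtn n)) E.
  by rewrite /position_bits /= drop0.
- have rs : all (gtn (arity R).+3) (iota 3 (arity R)).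
    by apply/allP => i; rewrite mem_iota => /andP[].
  rewrite /position_prog; apply: eq_test; last first.
    apply: test_and => //; first exact: test_lt_all.
    by apply: test_and => //; [apply: test_at | apply: test_not; apply: test_lookup].
  move=> x rx; have [u -> [su _]] := ready_env rx.
  have E : [seq nth 0 [:: n, size w & u] i | i <- iota 3 (arity R)] = behead u.
    by rewrite map_nth_drop /= ?drop1 // su.
  rewrite -[X in X && _](all_map (nth 0 [:: n, size w & u]) (gtn n)) E.
  by rewrite /position_bits /= drop0.
- rewrite /position_prog; apply: eq_test; last first.
    by apply: test_and => //; [apply: test_le | apply: test_not; apply: test_le].
  by move=> x rx; have [u -> _] := ready_env rx; rewrite /= drop0 -ltnNge.
- rewrite /position_prog; apply: eq_test; last first.
    apply: test_and => //; first by apply: test_not; apply: test_le.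
    apply: test_and => //; first by apply: test_not; apply: test_le.
    apply: test_if => //; [exact: test_succ | exact: test_done |].
    by apply: test_and => //; [apply: test_zero | apply: test_succ].
  move=> x rx; have [u -> _] := ready_env rx; rewrite /= drop0 -!ltnNge.
  by case: (_ == _.+1).
Qed.

End Reductions.


(** * From hereditary structures back *)

Lemma run_setup (sigma : signature) (A : structure sigma) :
  exists x, [/\ rexec (encode A) init_prog start_state false x,
    forall c m, c > 0 -> ready (encode A) #|dom A| c m x & out x = [::]].
Proof.
have [x [rx bx xz ox]] := run_init (encode_tables A).
exists x; split=> // c m c0; split=> // j /andP[j1 _].
by rewrite xz.
Qed.

Lemma logspace_const (tau sigma : signature) (B : structure sigma) :
  logspace_computable (fun _ : structure tau => B).
Proof.
apply: (@logspace_computable_rprog _ _ _ (rseq init_prog (print_prog (encode B)))) => A.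
have [x [rx rdx ox]] := run_setup A.
have [b [y [ry _ oy]]] := emits_print (encode B) (isT : 1 < 2) (rdx 1 2 isT).
by exists b, y; split; [apply: run_seq rx ry | rewrite oy ox].
Qed.

Lemma sat_closure (sigma : signature) (A : structure sigma) p (v : nat -> dom A) :
  sat v (foralls (free_vars p) p) <-> forall v' : nat -> dom A, sat v' p.
Proof.
rewrite sat_foralls; split=> [H v'|H v' _]; last exact: H.
pose u i := if i \in free_vars p then v' i else v i.
have su : sat u p by apply: H => i /negPf ip; rewrite /u ip.
by rewrite -(eq_sat_free (v := u)) // => i ip; rewrite /u ip.
Qed.

(** The variable [m] may be bound in [phi] but is not among the entries of the
    environment; resetting its register makes its value a legal element. *)
Lemma test_eval_fresh (sigma : signature) (A : structure sigma)
    (phi : formula sigma) m : var_bound phi <= m.+1 ->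
  test (encode A) #|dom A| #|dom A| m.+2
    (rseq (Reset m.+2) (eval_prog phi m.+3))
    (fun e => sat (fun i => elem A (nth 0 e i.+2)) phi).
Proof.
move=> phim x [bx xc]; have [bx' x0 x1] := bx.
set x' := set_reg m.+2 0 x.
have bxs : based (encode A) #|dom A| x'.
  by split; rewrite //=; apply: bounded_set.
have [|i im|y [ry Ey oy]] := @run_eval _ A m.+1 phi m.+3 x'
  (fun i => elem A (nth 0 (env m.+2 x) i.+2)) phim _ bxs.
- by [].
- move: im; rewrite ltnS leq_eqVlt => /orP[/eqP->|im].
    have -> : reg x' m.+2 = 0 by rewrite /= eqxx.
    by rewrite nth_default ?size_mkseq //; split=> //; apply: dom_gt0.
  by rewrite nth_env //= !eqSS ltn_eqF //; split=> //; apply: xc; rewrite !ltnS im.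
exists y; split=> //.
  exact: run_seq (run_reset _ _ _) ry.
by rewrite (env_weaken Ey) env_set.
Qed.

Section Reductions.
Variables (tau : signature) (Psi : eso tau).
Local Notation rho := (eso_sig Psi).
Variable prime : sym rho -> sym tau.
Hypothesis prime_inj : injective prime.
Hypothesis ext : extended_by prime.
Local Notation hs := (her_sig tau rho).
Local Notation phi := (@her_sentence tau Psi prime).

Theorem positions_logspace : logspace_computable (positions prime).
Proof.
apply: (@logspace_computable_rprog _ _ _ (rseq init_prog
  (structure_prog 1 (fun=> rdone true) (position_prog prime)))) => A.
have [x [rx rdx ox]] := run_setup A.
have w0 : 0 < size (encode A) by apply: leq_ltn_trans (size_encode_gt A).
have [||b [y [ry _ oy]]] := @emits_structure (encode A) #|dom A| (size (encode A)) hs 1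
  (fun=> rdone true) (position_prog prime) predT (position_bits prime A) isT _ _
  (fun R => @test_position_prog tau Psi prime A R) x (rdx _ _ w0).
- by move=> y [].
- by move=> l _; apply: test_done.
exists b, y; split; first exact: run_seq rx ry.
by rewrite oy ox filter_predT /positions encode_tabulated.
Qed.

(** An extension symbol holds for the tuples to which no element is tied; the
    variable [arity R] is the first one that is not an entry of the tuple. *)
Definition recover_formula (Q : sym tau) : formula hs :=
  if [pick R | prime R == Q] is Some R then
    FNot (FEx (arity R) (@f_del tau rho R (arity R) [tuple of iota 0 (arity R)]))
  else @FRel hs (keep rho Q) [tuple of iota 0 (arity Q)].

Lemma recover_formula_prime R : recover_formula (prime R) =
  FNot (FEx (arity R) (@f_del tau rho R (arity R) [tuple of iota 0 (arity R)])).
Proof.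
rewrite /recover_formula; case: pickP => [R' /eqP/prime_inj->//|/(_ R)].
by rewrite eqxx.
Qed.

Lemma recover_formula_keep Q : Q \notin codom prime ->
  recover_formula Q = @FRel hs (keep rho Q) [tuple of iota 0 (arity Q)].
Proof.
rewrite /recover_formula; case: pickP => // R /eqP<- /negP[].
exact: codom_f.
Qed.

Lemma var_bound_recover Q : var_bound (recover_formula Q) <= (arity Q).+1.
Proof.
have bnd k : \max_(i <- iota 0 k) i <= k.
  by apply/bigmax_leqP_seq => i; rewrite mem_iota => /ltnW.
rewrite /recover_formula; case: pickP => [R /eqP<-|_] /=; last by rewrite ltnS.
rewrite (arity_prime ext) geq_max leqnn /= ltnS big_cons geq_max leqnn.
exact: bnd.
Qed.

Section Recover.
Variable B : structure hs.
Local Notation w := (encode B).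
Local Notation n := #|dom B|.

Definition in_order (i : nat) : bool := le (elem B i) (elem B i).

(** Enumerates the ordered part as the domain is enumerated, not along the order
    of [B]: the order serves only to force elements into substructures. *)
Definition order_seq : seq nat := [seq i <- iota 0 n | in_order i].

Definition recover_bits (Q : sym tau) (u : seq nat) : bool :=
  sat (fun i => elem B (nth 0 u i)) (recover_formula Q).

Lemma recover_bits_keep Q u : Q \notin codom prime -> size u = arity Q ->
  recover_bits Q u = @holds _ B (keep rho Q) (map (elem B) u).
Proof.
move=> Qp su; rewrite /recover_bits recover_formula_keep // sat_FRel.
rewrite (map_comp (elem B) (nth 0 u)); congr (holds _ (map _ _)).
by rewrite /= -su map_nth_iota0 // take_size.
Qed.

Lemma recover_bits_prime R u : size u = arity R ->
  recover_bits (prime R) u = ~~ [exists t : dom B, deletes R t (map (elem B) u)].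
Proof.
move=> su; rewrite /recover_bits recover_formula_prime sat_FNot sat_FEx.
congr (~~ _); apply: eq_existsb => t; rewrite sat_del /= eqxx.
congr deletes; transitivity (map (elem B) [seq nth 0 u i | i <- iota 0 (arity R)]).
  rewrite -map_comp; apply/eq_in_map => i; rewrite mem_iota add0n => /= lt.
  by rewrite ltn_eqF.
by rewrite -su map_nth_iota0 // take_size.
Qed.

Section Linked.
Hypothesis size_gt0 : 0 < size order_seq.

Definition recovered : structure tau := tabulated size_gt0 recover_bits.

Definition recover_elem (a : dom recovered) : dom B :=
  elem B (nth 0 order_seq (val a)).

Lemma order_seq_nth (a : dom recovered) :
  nth 0 order_seq (val a) < n /\ in_order (nth 0 order_seq (val a)).
Proof.
have : nth 0 order_seq (val a) \in order_seq by apply: mem_nth; apply: ltn_ord.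
by rewrite mem_filter mem_iota => /andP[-> /andP[_]].
Qed.

Theorem recovered_correct : wellformed B -> linked B ->
  (Her phi B <-> ~ eso_models recovered Psi).
Proof.
move=> wf lk.
have map_elem (u : seq (dom recovered)) :
  map (elem B) [seq nth 0 order_seq (val i) | i <- u] = map recover_elem u.
  by rewrite -map_comp.
apply: (her_link prime_inj ext (e := recover_elem)) => //.
- move=> a b /(congr1 (@code _ B)); have [an _] := order_seq_nth a.
  have [bn _] := order_seq_nth b; rewrite /recover_elem !elemK // => /eqP.
  rewrite nth_uniq ?ltn_ord //; last by rewrite filter_uniq // iota_uniq.
  by move/eqP/val_inj.
- by move=> a; have [_] := order_seq_nth a.
- move=> c cc; have cL : code c \in order_seq.
    by rewrite mem_filter mem_iota /in_order codeK cc code_lt.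
  have lt : index (code c) order_seq < size order_seq by rewrite index_mem.
  by exists (Ordinal lt); rewrite /recover_elem /= nth_index // codeK.
- move=> Q u Qp; rewrite holds_tabulated; case: eqP => [su|su] /=.
    by rewrite recover_bits_keep ?size_map // map_elem.
  by apply/esym/negP => /holds_size; rewrite size_map.
- move=> R u su; rewrite holds_tabulated su (arity_prime ext) eqxx /=.
  by rewrite recover_bits_prime ?size_map // map_elem.
Qed.

End Linked.

Lemma linked_size : linked B -> 0 < size order_seq.
Proof.
case=> -[x xx] _; rewrite size_filter -has_count; apply/hasP; exists (code x).
  by rewrite mem_iota code_lt.
by rewrite /in_order codeK.
Qed.

End Recover.

Definition order_prog (l : nat) : rprog := @lookup hs (ord tau rho) [:: l; l] l.+1.

Lemma test_order_prog (B : structure hs) l : 1 < l ->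
  test (encode B) #|dom B| #|dom B| l.+1 (order_prog l)
    (fun e => in_order B (nth 0 e l)).
Proof.
move=> l1; rewrite /order_prog; apply: eq_test; last first.
  by apply: test_lookup; [apply: (ltnW l1) | rewrite /= ltnS leqnn].
move=> x [_ xc]; rewrite nth_env // [map _ _]/= nth_env //.
have lt : reg x l < #|dom B| by apply: xc; rewrite l1 ltnSn.
by rewrite encode_bit //= lt.
Qed.

Definition closed_alpha : formula hs :=
  foralls (free_vars (alpha tau rho)) (alpha tau rho).

Definition recover_body (Q : sym tau) : rprog :=
  rseq (Reset (arity Q).+2) (eval_prog (recover_formula Q) (arity Q).+3).

Section Recovery.
Variables (yes no : structure tau).

Definition recovered_or (B : structure hs) : structure tau :=
  match @idP (0 < size (order_seq B)) with
  | ReflectT h => recovered h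
  | ReflectF _ => no
  end.

(** A structure that violates [alpha] is not hereditary, so it is sent to a model
    of Psi; one that satisfies [alpha] but not [chain] is hereditary, so it is
    sent to a structure without solutions. *)
Definition recovery (B : structure hs) : structure tau :=
  if sat (fun=> elem0 B) closed_alpha then
    if sat (fun=> elem0 B) (chain tau rho) then recovered_or B else no
  else yes.

Definition recovery_prog : rprog :=
  let m := (maxn (var_bound closed_alpha) (var_bound (chain tau rho))).+2 in
  rseq init_prog
    (RIf (eval_prog closed_alpha m)
       (RIf (eval_prog (chain tau rho) m)
          (structure_prog 0 order_prog recover_body)
          (print_prog (encode no)))
       (print_prog (encode yes))).

Lemma run_sentence (sigma : signature) (B : structure sigma) p m x b :
  var_bound p <= m -> ready (encode B) #|dom B| #|dom B| m.+2 x ->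
  (forall v : nat -> dom B, sat v p = b) ->
  exists y, [/\ rexec (encode B) (eval_prog p m.+2) x b y,
    ready (encode B) #|dom B| #|dom B| m.+2 y & out y = out x].
Proof.
move=> pm rx pb; have [y [ry Ey oy]] := test_eval pm rx.
rewrite pb in ry; exists y; split=> //.
exact: ready_run ry Ey rx.
Qed.

Lemma ready_base (w : seq bool) n c m x : ready w n c m x -> ready w n c 2 x.
Proof. by move=> [bx _]; split=> // -[|[|j]]. Qed.

Theorem recovery_logspace : logspace_computable recovery.
Proof.
apply: (@logspace_computable_rprog _ _ _ recovery_prog) => B.
have [x [rx rdx ox]] := run_setup B.
have n0 := dom_gt0 B.
set m := maxn (var_bound closed_alpha) (var_bound (chain tau rho)).
have indep_a (v : nat -> dom B) : sat v closed_alpha = sat (fun=> elem0 B) closed_alpha.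
  by apply/idP/idP => /sat_closure h; apply/sat_closure.
have indep_c (v : nat -> dom B) : sat v (chain tau rho) = sat (fun=> elem0 B) (chain tau rho).
  by apply/idP/idP => /chainP h; apply/chainP.
have [y [ry rdy oy]] := run_sentence (leq_maxl _ _) (rdx _ m.+2 n0) indep_a.
have [z [rz rdz oz]] := run_sentence (leq_maxr _ _) rdy indep_c.
rewrite /recovery; case: ifP ry => sa ry; last first.
  have [b [x' [rx' _ ox']]] := emits_print (encode yes) (isT : 1 < 2) (ready_base rdy).
  exists b, x'; split; last by rewrite ox' oy ox.
  by apply: run_seq rx _; apply: RxIf ry rx'.
case: ifP rz => sc rz; last first.
  have [b [x' [rx' _ ox']]] := emits_print (encode no) (isT : 1 < 2) (ready_base rdz).
  exists b, x'; split; last by rewrite ox' oz oy ox.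
  by apply: run_seq rx _; apply: RxIf ry _; apply: RxIf rz rx'.
have [||b [x' [rx' _ ox']]] := @emits_structure (encode B) #|dom B| #|dom B| tau 0
  order_prog recover_body (in_order B) (recover_bits B) isT _
  (fun l => @test_order_prog B l) _ z (ready_base rdz).
- by move=> t [].
- move=> Q; apply: eq_test; last exact: (@test_eval_fresh hs B _ _ (var_bound_recover Q)).
  move=> t rt; have [u -> _] := ready_env rt; rewrite /recover_bits /= drop0.
  by apply: eq_sat.
exists b, x'; split.
  by apply: run_seq rx _; apply: RxIf ry _; apply: RxIf rz rx'.
rewrite ox' oz oy ox /recovered_or; case: {-}_ / idP => [h|[]].
  by rewrite encode_tabulated.
by move/chainP: sc => /linked_size.
Qed.

Hypothesis yesP : eso_models yes Psi.
Hypothesis noP : ~ eso_models no Psi.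

Theorem recovery_correct (B : structure hs) :
  Her phi B <-> ~ eso_models (recovery B) Psi.
Proof.
rewrite /recovery; case: ifP => [/sat_closure/alphaP wf|sa]; last first.
  split=> // /her_wellformed /alphaP h; case/negP: (negbT sa).
  exact/sat_closure.
case: ifP => [/chainP lk|sc]; last first.
  split=> // _; apply: her_unlinked wf _ => lk.
  by case/negP: (negbT sc); apply/chainP.
rewrite /recovered_or; case: {-}_ / idP => [h|[]]; last exact: linked_size.
exact: recovered_correct.
Qed.

End Recovery.
End Reductions.

Theorem theorem4p5 (tau : signature) (Psi : eso tau) (hPsi : extensional Psi) :
  exists (sigma : signature) (phi : formula sigma),
    sentence phi /\
    logspace_equivalent (fun A : structure tau => ~ eso_models A Psi)
                        (@Her sigma phi).
Proof.
have [prime prime_inj ext] := hPsi.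
have unit_gt0 : 0 < #|{: unit}| by rewrite card_unit.
pose triv sigma : structure sigma := @Structure sigma unit unit_gt0 (fun=> set0).
have Her_false sigma (B : structure sigma) : ~ Her (@FFalse sigma) B.
  move=> H; have h : [set: dom B] != set0 by apply/set0Pn; exists (elem0 B).
  by have := H _ h (fun=> elem0 (induced h)).
case: (classic (exists A, eso_models A Psi)) => [[yes yesP]|none]; last first.
  exists tau, (FNot FFalse); split=> //.
  split; exists (fun _ => triv tau) => [|A]; try exact: logspace_const.
  - by split=> // _ eA; apply: none; exists A.
  - by split=> // _ eA; apply: none; exists (triv tau).
case: (classic (exists A, ~ eso_models A Psi)) => [[no noP]|all_yes]; last first.
  have yes_all A : eso_models A Psi.
    by apply: NNPP => nA; apply: all_yes; exists A.
  exists tau, FFalse; split=> //.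
  split; exists (fun _ => triv tau) => [|A]; try exact: logspace_const.
  - by split=> [/(_ (yes_all A))|/Her_false].
  - by split=> [/Her_false|/(_ (yes_all _))].
exists (her_sig tau (eso_sig Psi)), (@her_sentence tau Psi prime).
split; first exact: her_sentence_closed.
split.
  exists (positions prime); first exact: positions_logspace.
  by move=> A; rewrite (positions_correct prime_inj ext).
exists (recovery prime yes no); first exact: recovery_logspace.
by move=> B; apply: recovery_correct.
Qed.
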